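(* Suppose $R$ is not Gorenstein. (1) The following are equivalent: (a) $b<r-1$; (b) $v(R)=\{0,e,\dots,pe,c\to\}$ with $pe+2<c\le(p+1)e$; (c) the type sequence of $R$ is $[e-1,e-1,\dots,e-1,r_n]$ with $r_n>1$. If these conditions hold, then $l_R(R/(\gamma+xR))=1$, $c=(p+1)e-b$, $r=e-1$ and $r_n=e-1-b$. (2) If $b=r-1$, then $r=e-1$ or $r=e-2$. Moreover: First case. The following are equivalent: (a) $b=r-1=e-2$; (b) $v(R)=\{0,e,\dots,pe,c\to\}$ with $c=pe+2$; (c) the type sequence of $R$ is $[e-1,e-1,\dots,e-1,1]$. If these conditions hold, then $l_R(R/(\gamma+xR))=1$. Second case. The following are equivalent: (d) $b=r-1=e-3$; (e) either $v(R)=\{0,e,2e-1,2e,3e-1\to\}$, or $v(R)=\{0,e,y,2e\to\}$ with $e<y\le e+\frac{e-1}{2}$; (f) the type sequence of $R$ is either $[e-2,e-2,r_3,r_4]$ with $r_3+r_4=e-1$, or $[e-2,r_2,r_3]$ with $r_2+r_3=e-1$. If these conditions hold, then $l_R(R/(\gamma+xR))=2$. (3) If $b=r$, then one of the following holds: (g) $r=e-2$ and $l_R(R/(\gamma+xR))=2$; or (j) $r=2$, $e=5$ and $l_R(R/(\gamma+xR))=3$. In case (g), $v(R)$ is one of the following sets: $\{0,4,8,9,12,13,16\to\}$; $\{0,4,8,11,12,15,16,19\to\}$; $\{0,e,2e-2,2e,3e-2\to\}$ with $e\ge4$; $\{0,e,e+z,2e-1\to\}$ with $0<z\le\frac{e-2}{2}$,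 $e\ge4$. In case (j), $v(R)$ is one of the following sets: $\{0,5,6,7,10\to\}$; $\{0,5,6,8,10\to\}$; $\{0,5,8,9,10,13\to\}$.
   Context: Setting: $(R,\mathfrak m)$ is a one-dimensional Noetherian local domain with infinite residue field $k$ and fraction field $K$. Its integral closure $\overline R$ in $K$ is a finite $R$-module and a discrete valuation ring with uniformizer $t$ (analytically irreducible), and $R$ is residually rational: the natural map $k\to\overline R/t\overline R$ is an isomorphism. $v:K\to\mathbb Z\cup\{\infty\}$ is the valuation of $\overline R$ with $v(t)=1$, and $v(R)=\{v(a):0\ne a\in R\}$. $l_R$ denotes length of $R$-modules; $I:J=\{x\in K: xJ\subseteq I\}$. Put $\gamma=R:\overline R=t^c\overline R$ with $c=l_R(\overline R/\gamma)$, $\delta=l_R(\overline R/R)$, $n=c-\delta=l_R(R/\gamma)$, $r=l_R((R:\mathfrak m)/R)$ (Cohen–Macaulay type), $b=b(\gamma)=r(c-\delta)-\delta$. $e=\min v(\mathfrak m)$ is the multiplicity of $R$ and $x\in\mathfrak m$ is an element with $v(x)=e$. $p$ denotes the integer such that $c-e\le pe<c$, with $p\ge1$. Type sequence: let $s_0=0<s_1<\dots<s_n=c<\dots$ be the elements of $v(R)$, $R_i=\{a\in R: v(a)\ge s_i\}$, and $r_i=l_R\big((R:R_i)/(R:R_{i-1})\big)$ for $i\ge1$; the type sequence of $R$ is $[r_1,\dots,r_n]$ (so $r_1=r$). Notation: $y$ and $z$ denote integers; in a set of nonnegative integers, ''$m\to$'' means that all integers $\ge m$ belong to the set; the elements are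 listed in increasing order, and $\{0,e,\dots,pe,c\to\}=\{0,e,2e,\dots,pe\}\cup\{j\in\mathbb Z:j\ge c\}$. *)

(* Defs.v *)
From HB Require Import structures.
From mathcomp Require Import all_boot all_order all_algebra.
From mathcomp Require Import mathcomp_extra boolp classical_sets functions.
From mathcomp Require Import cardinality constructive_ereal.

Set Implicit Arguments.
Unset Strict Implicit.
Unset Printing Implicit Defensive.

Import Order.TTheory GRing.Theory Num.Theory.

Local Open Scope classical_set_scope.
Local Open Scope ring_scope.

Reserved Notation "x %:F" (format "x %:F").
Notation "x %:F" := (tofrac x) : ring_scope.

Section FractionModule.
Variable R : idomainType.

Definition fraction_scale (a : R) (x : {fraction R}) : {fraction R} := a%:F * x.

Lemma fraction_scaleA a b x :
  fraction_scale a (fraction_scale b x) = fraction_scale (a * b) x.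
Proof. by rewrite /fraction_scale mulrA tofracM. Qed.

Lemma fraction_scale1 : left_id 1 fraction_scale.
Proof. by move=> x; rewrite /fraction_scale tofrac1 mul1r. Qed.

Lemma fraction_scaleDr : right_distributive fraction_scale +%R.
Proof. by move=> a x y; rewrite /fraction_scale mulrDr. Qed.

Lemma fraction_scaleDl x : {morph fraction_scale^~ x : a b / a + b}.
Proof. by move=> a b; rewrite /fraction_scale tofracD mulrDl. Qed.

HB.instance Definition _ := GRing.Zmodule_isLmodule.Build R {fraction R}
  fraction_scaleA fraction_scale1 fraction_scaleDr fraction_scaleDl.

End FractionModule.

Section Modules.
Variables (R : idomainType) (V : lmodType R).
Implicit Types M N : set V.

Definition submodule N : Prop := submod_closed [in N].

Definition finitely_generated N : Prop :=
  exists (n : nat) (g : 'I_n -> V),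
    N = [set \sum_(i < n) a i *: g i | a in [set: 'I_n -> R]].

Definition submodule_chain N M (n : nat) : Prop :=
  exists C : nat -> set V,
    [/\ C 0%N = N, C n = M,
        forall i, (i <= n)%N -> submodule (C i) &
        forall i, (i < n)%N -> C i `<` C i.+1].

(* [len M N] is the length of M / N; it is meaningful when N and M are
   submodules with N `<=` M and M / N has finite length (otherwise it is 0). *)
Definition len M N : nat :=
  xget 0%N [set l | submodule_chain N M l /\
                    forall n, submodule_chain N M n -> (n <= l)%N].

End Modules.

Definition cosets (V : zmodType) (M N : set V) : set (set V) :=
  [set [set x + y | y in N] | x in M].

Section Rings.
Variable R : idomainType.
Implicit Types I P : set R.

Definition ideal I : Prop := submodule (I : set R^o).

Definition noetherian : Prop :=
  forall I, ideal I -> finitely_generated (I : set R^o).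

Definition prime_ideal P : Prop :=
  [/\ ideal P, ~ P 1 & forall a b : R, P (a * b) -> P a \/ P b].

Definition maximal_ideal P : Prop :=
  [/\ ideal P, ~ P 1 &
      forall I, ideal I -> P `<=` I -> I = P \/ I = setT].

Definition local_ring P : Prop :=
  maximal_ideal P /\ forall I, maximal_ideal I -> I = P.

Definition prime_chain (n : nat) : Prop :=
  exists P : nat -> set R,
    (forall i, (i <= n)%N -> prime_ideal (P i)) /\
    (forall i, (i < n)%N -> P i `<` P i.+1).

Definition krull_dim (d : nat) : Prop :=
  prime_chain d /\ forall n, prime_chain n -> (n <= d)%N.

Definition injective_module (E : lmodType R) : Prop :=
  forall (M N : lmodType R) (f : {linear M -> N}) (g : {linear M -> E}),
    injective f -> exists h : {linear N -> E}, forall x, h (f x) = g x.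

(* An injective resolution 0 -> M -> E_0 -> ... -> E_d -> 0, cut into short
   exact sequences 0 -> M -> E -> C -> 0. *)
Fixpoint injdim_le (d : nat) (M : lmodType R) : Prop :=
  if d is d'.+1 then
    exists (E C : lmodType R) (i : {linear M -> E}) (q : {linear E -> C}),
      [/\ injective_module E, injective i, forall y, exists x, q x = y,
          forall x, q x = 0 <-> exists y, i y = x & injdim_le d' C]
  else injective_module M.

(* Definition for a Noetherian local ring: finite injective dimension over
   itself. *)
Definition gorenstein : Prop := exists d, injdim_le d R^o.

End Rings.

Section Valuation.
Variable F : fieldType.

Definition discrete_valuation (v : F -> \bar int) : Prop :=
  [/\ forall x, v x != -oo%E,
      forall x, v x = +oo%E <-> x = 0,
      forall x y, v (x * y) = (v x + v y)%E,
      forall x y, (Order.min (v x) (v y) <= v (x + y)%R)%E &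
      exists x, v x = 1%:E].

Definition valuation_ring (v : F -> \bar int) : set F :=
  [set x | (0 <= v x)%E].

End Valuation.

Section Invariants.
Variable R : idomainType.
Local Notation K := {fraction R}.
Implicit Types (I J : set K) (v : K -> \bar int) (m : set R).

Definition embed (A : set R) : set K := [set a%:F | a in A].

(* R itself, seen inside K *)
Definition ringK : set K := embed setT.

Definition int_closure : set K := [set z | integralOver (@tofrac R) z].

Definition colon I J : set K := [set z | forall y, J y -> I (z * y)].

(* the ideal t Rbar of Rbar *)
Definition unif_ideal (t : K) : set K := [set t * z | z in int_closure].

(* The coset a + m is sent to (a + m) + t Rbar, which is the coset a + t Rbar
   since m is contained in t Rbar. *)
Definition residually_rational m (t : K) : Prop :=
  set_bij (cosets [set: R] m) (cosets int_closure (unif_ideal t))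
    (fun C => [set a%:F + z | a in C & z in unif_ideal t]).

Definition values v (A : set R) : set nat :=
  [set k | exists a : R, [/\ A a, a != 0 & v a%:F = (k%:Z)%:E]].

Definition value_set v : set nat := values v setT.

Definition conductor : set K := colon ringK int_closure.
Definition cond_len : nat := len int_closure conductor.
Definition delta : nat := len int_closure ringK.
Definition cm_type m : nat := len (colon ringK (embed m)) ringK.
Definition b_inv m : int :=
  (cm_type m)%:Z * (cond_len%:Z - delta%:Z) - delta%:Z.

Definition filt v (s : nat -> nat) (i : nat) : set R :=
  [set a | ((s i)%:Z%:E <= v a%:F)%E].

Definition type_term v (s : nat -> nat) (i : nat) : nat :=
  len (colon ringK (embed (filt v s i))) (colon ringK (embed (filt v s i.-1))).

Definition type_seq v (s : nat -> nat) : seq nat :=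
  [seq type_term v s i | i <- iota 1 (len ringK conductor)].

(* gamma + xR *)
Definition cond_plus (x : R) : set K :=
  [set g + (x * a)%:F | g in conductor & a in [set: R]].

End Invariants.

(* The set of the elements of [l] and of all integers >= c. *)
Definition list_then (l : seq nat) (c : nat) : set nat :=
  [set j | (j \in l) || (c <= j)%N].

Arguments noetherian R : clear implicits.
Arguments krull_dim R d : clear implicits.
Arguments gorenstein R : clear implicits.
Arguments ringK R : clear implicits.
Arguments int_closure R : clear implicits.
Arguments conductor R : clear implicits.
Arguments cond_len R : clear implicits.
Arguments delta R : clear implicits.

(* Main.v *)
Require Import Defs.
From HB Require Import structures.
From mathcomp Require Import all_boot all_order all_algebra.
From mathcomp Require Import mathcomp_extra boolp classical_sets functions.
From mathcomp Require Import cardinality constructive_ereal.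
From mathcomp Require Import zify.

Set Implicit Arguments.
Unset Strict Implicit.
Unset Printing Implicit Defensive.

Import Order.TTheory GRing.Theory Num.Theory.

Local Open Scope classical_set_scope.
Local Open Scope ring_scope.

(** Every length in sight is a count of values: if N is contained in M, both
    being fractional ideals, then the length of M / N is the number of elements
    of v(M) that are missing from v(N) ([len_cnt]), because the residue field
    of R is that of its integral closure.  Hence c, n and l = l(R/(gamma + xR))
    can be read off the numerical semigroup S = v(R): c is its conductor, n the
    number of its elements below c, and l the number of its elements in the
    window [c - e, c), one for each residue class mod e that meets S below c.
    As delta + n = c, the invariant b satisfies b + c = (r + 1) n.

    The type r is not determined by S, but it is controlled by it.  The values
    of R : m outside S are pairwise incongruent mod e and not divisible by e,
    so r <= e - 1, and they include all of [c - e, c) outside S, so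
    r >= e - l.  If r = e - l, no value below c - e of R : m lies outside S;
    writing an element of m modulo xR then produces, for each w in S below c
    with w >= e and w - e outside S, an element w' > 0 of the same kind (w' = w
    is possible) such that w + w' < c + e ([small_sum]).

    The inequality that drives everything bounds delta.  A simple step of J / J'
    adds at most r to the length of (R : J') / (R : J) ([len_colon_le]), while
    R : J contains R and all of t^e Rbar when J consists of the elements of
    value at least c - e.  Splitting Rbar / R at R : J gives
    delta <= r (n - l) + (e - 1), that is b >= r l - (e - 1), and hence
    b >= (r - 1)(l - 1).  So b < r - 1 forces l = 1, b = r - 1 forces l <= 2
    and b = r forces l <= 3.  For l = 1 the semigroup consists of multiples of
    e up to the conductor.  For l = 2 and l = 3 there remain one or two
    arithmetic progressions of step e, and the bound on w + w' leaves finitely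
    many families.

    The terms of the type sequence are at most r and add up to delta, so when
    a bound of this kind is attained all terms but the last l are equal to r;
    this translates statements on b into statements on the type sequence.

    The hypothesis that R is not Gorenstein enters through r > 1.  If r = 1,
    the length bound for R : J shows that J |-> R : J is strictly decreasing,
    and then every homomorphism from an ideal to K / R is multiplication by an
    element of K / R: it can be extended one simple step at a time, the
    obstruction living in (R : m) / R, which is simple.  By Baer's criterion
    0 -> R -> K -> K / R -> 0 is an injective resolution. *)

(** * Submodules of the fraction field *)

Lemma submoduleP (R : idomainType) (V : lmodType R) (N : set V) :
  submodule N <->
  N 0 /\ forall (a : R) (y z : V), N y -> N z -> N (a *: y + z).
Proof.
split=> -[N0 Nl]; split; rewrite ?in_setE //.
- by move: N0; rewrite in_setE.
- by move=> a y z Ny Nz; move: (Nl a y z); rewrite !in_setE; apply.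
- by move=> a y z; rewrite !in_setE; exact: Nl.
Qed.

Section FractionSubmodules.
Variable R : idomainType.
Local Notation K := {fraction R}.
Implicit Types (N M : set K).

Lemma fracZE (a : R) (y : K) : a *: y = a%:F * y.
Proof. by []. Qed.

Lemma submod0 N : submodule N -> N 0.
Proof. by case/submoduleP. Qed.

Lemma submodD N y z : submodule N -> N y -> N z -> N (y + z).
Proof.
by case/submoduleP=> _ Nl Ny Nz; have := Nl 1 y z Ny Nz; rewrite scale1r.
Qed.

Lemma submodM N (a : R) y : submodule N -> N y -> N (a%:F * y).
Proof.
by case/submoduleP=> N0 Nl Ny; have := Nl a y 0 Ny N0; rewrite addr0.
Qed.

Lemma submodN N y : submodule N -> N y -> N (- y).
Proof.
by move=> sN Ny; rewrite -mulN1r -tofrac1 -tofracN; exact: submodM.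
Qed.

Lemma submodB N y z : submodule N -> N y -> N z -> N (y - z).
Proof. by move=> sN Ny Nz; apply: submodD => //; exact: submodN. Qed.

Lemma submoduleI N : N 0 -> (forall y z, N y -> N z -> N (y + z)) ->
  (forall (a : R) y, N y -> N (a%:F * y)) -> submodule N.
Proof.
by move=> N0 ND NM; apply/submoduleP; split=> // a y z Ny Nz; apply/ND/Nz/NM.
Qed.

Definition addm N M : set K := [set y + z | y in N & z in M].

Lemma addm_sub N M : submodule N -> submodule M -> submodule (addm N M).
Proof.
move=> sN sM; apply: submoduleI.
- by exists 0; [exact: submod0|exists 0; [exact: submod0|rewrite addr0]].
- move=> _ _ [y Ny [z Mz <-]] [y' Ny' [z' Mz' <-]].
  exists (y + y'); first exact: submodD.
  by exists (z + z'); [exact: submodD|rewrite addrACA].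
- move=> a _ [y Ny [z Mz <-]].
  exists (a%:F * y); first exact: submodM.
  by exists (a%:F * z); [exact: submodM|rewrite mulrDr].
Qed.

Lemma addm_l N M : submodule M -> N `<=` addm N M.
Proof. by move=> sM y Ny; exists y => //; exists 0; [exact: submod0|rewrite addr0]. Qed.

Lemma addm_r N M : submodule N -> M `<=` addm N M.
Proof. by move=> sN y My; exists 0; [exact: submod0|exists y => //; rewrite add0r]. Qed.

Lemma addm_le N M P : submodule P -> N `<=` P -> M `<=` P -> addm N M `<=` P.
Proof.
by move=> sP NP MP _ [y Ny [z Mz <-]]; apply: submodD; [|exact: NP|exact: MP].
Qed.

Definition line (b : K) : set K := [set a%:F * b | a in [set: R]].

Lemma line_sub b : submodule (line b).
Proof.
apply: submoduleI; first by exists 0; rewrite ?tofrac0 ?mul0r.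
- by move=> _ _ [a _ <-] [a' _ <-]; exists (a + a'); rewrite ?tofracD ?mulrDl.
- by move=> a _ [a' _ <-]; exists (a * a'); rewrite ?tofracM ?mulrA.
Qed.

Lemma line_mem b : line b b.
Proof. by exists 1; rewrite ?tofrac1 ?mul1r. Qed.

Lemma line_le b N : submodule N -> N b -> line b `<=` N.
Proof. by move=> sN Nb _ [a _ <-]; exact: submodM. Qed.

Definition scalem (b : K) N : set K := [set b * y | y in N].

Lemma scalem_sub b N : submodule N -> submodule (scalem b N).
Proof.
move=> sN; apply: submoduleI; first by exists 0; [exact: submod0|rewrite mulr0].
- move=> _ _ [y Ny <-] [z Nz <-].
  by exists (y + z); [exact: submodD|rewrite mulrDr].
- by move=> a _ [y Ny <-]; exists (a%:F * y); [exact: submodM|rewrite mulrCA].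
Qed.

Lemma scalemP b N y : b != 0 -> scalem b N (b * y) <-> N y.
Proof.
by move=> b0; split=> [[z Nz /(mulfI b0) <-//]|Ny]; exists y.
Qed.

Lemma scalem_le b N M : N `<=` M -> scalem b N `<=` scalem b M.
Proof. by move=> NM _ [y /NM My <-]; exists y. Qed.

Lemma ringK_sub : submodule (ringK R).
Proof.
apply: submoduleI; first by exists 0; rewrite ?tofrac0.
- by move=> _ _ [a _ <-] [a' _ <-]; exists (a + a'); rewrite ?tofracD.
- by move=> a _ [a' _ <-]; exists (a * a'); rewrite ?tofracM.
Qed.

Lemma ringK_mem (a : R) : ringK R a%:F.
Proof. by exists a. Qed.

Lemma ringK_mul y z : ringK R y -> ringK R z -> ringK R (y * z).
Proof. by move=> [a _ <-] [b _ <-]; exists (a * b); rewrite ?tofracM. Qed.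

Lemma colon_sub N M : submodule N -> submodule (colon N M).
Proof.
move=> sN; apply: submoduleI; first by move=> y _; rewrite mul0r; exact: submod0.
- by move=> y z Ny Nz u Mu; rewrite mulrDl; apply: submodD; [|exact: Ny|exact: Nz].
- by move=> a y Ny u Mu; rewrite -mulrA; apply: submodM => //; exact: Ny.
Qed.

Lemma colon_le N M P : M `<=` P -> colon N P `<=` colon N M.
Proof. by move=> MP y Ny z /MP; exact: Ny. Qed.

Lemma colon_ringK : colon (ringK R) (ringK R) = ringK R.
Proof.
apply/seteqP; split=> [y Ry|y Ry z]; last exact: ringK_mul.
by rewrite -[y]mulr1; apply: Ry; rewrite -tofrac1; exact: ringK_mem.
Qed.

End FractionSubmodules.

(** * Injectivity of K and of K / R *)

Section Baer.
Variables (R : idomainType) (E : lmodType R).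

(** A homomorphism from the ideal I to E is given as a function on R that is
    linear on I. *)
Definition baer : Prop := forall (I : set R) (phi : R -> E), ideal I ->
  (forall a b, I a -> I b -> phi (a + b) = phi a + phi b) ->
  (forall a b, I b -> phi (a * b) = a *: phi b) ->
  exists q : E, forall a, I a -> phi a = a *: q.

Section Extension.
Variables (M N : lmodType R) (f : {linear M -> N}) (g : {linear M -> E}).
Hypothesis f_inj : injective f.
Hypothesis E_baer : baer.

(** The partial extensions to which the maximality argument is applied are
    encoded by their graphs, which are ordered by inclusion. *)
Definition linear_graph (G : set (N * E)) : Prop :=
  [/\ G (0, 0), forall a (y y' : N) (z z' : E), G (y, z) -> G (y', z') ->
        G (a *: y + y', a *: z + z') & forall z, G (0, z) -> z = 0].

Let G0 : set (N * E) := [set (f x, g x) | x in [set: M]].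

Let G0_linear : linear_graph G0.
Proof.
split; first by exists 0; rewrite ?linear0.
- move=> a _ _ _ _ [x _ [<- <-]] [x' _ [<- <-]].
  by exists (a *: x + x'); rewrite ?linearP.
- by move=> z [x _ []]; rewrite -(linear0 f) => /f_inj -> <-; rewrite linear0.
Qed.

Lemma linear_graph_fun G y z z' : linear_graph G -> G (y, z) -> G (y, z') -> z = z'.
Proof.
move=> [G0' Gl Gf] h h'; apply/eqP; rewrite -subr_eq0; apply/eqP/Gf.
by have := Gl (-1) _ _ _ _ h' h; rewrite !scaleN1r addNr addrC.
Qed.

(* A chain of graphs may be empty, so the graph of g is adjoined to each member
   rather than required to be contained in it. *)
Let maximal_graph : exists H, [/\ linear_graph H, G0 `<=` H &
  forall B, linear_graph B -> H `<=` B -> B `<=` H].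
Proof.
have [F FP Ftot|A [PA Amax]] := @Zorn_bigcup _ (fun G => linear_graph (G `|` G0)).
  pose U := \bigcup_(X in F) X.
  have one p : (U `|` G0) p -> exists G, [/\ linear_graph (G `|` G0), (G `|` G0) p & G `<=` U].
    case=> [[X FX Xp]|h]; first by exists X; split; [exact: FP|left|exact: bigcup_sup].
    by exists set0; split; [rewrite set0U|right|].
  have two p q : (U `|` G0) p -> (U `|` G0) q ->
      exists G, [/\ linear_graph (G `|` G0), (G `|` G0) p, (G `|` G0) q & G `<=` U].
    case=> [[X FX Xp]|hp]; last by move=> /one[G [h1 h2 h3]]; exists G; split=> //; right.
    case=> [[Y FY Yq]|hq]; last first.
      by exists X; split; [exact: FP|left|right|exact: bigcup_sup].
    have [XY|YX] := Ftot X Y FX FY.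
      by exists Y; split; [exact: FP|left; exact: XY|left|exact: bigcup_sup].
    by exists X; split; [exact: FP|left|left; exact: YX|exact: bigcup_sup].
  split; first by right; case: G0_linear.
  - move=> a y y' z z' hp hq; have [G [[_ Gl _] h1 h2 GU]] := two _ _ hp hq.
    by case: (Gl a _ _ _ _ h1 h2) => [/GU|]; [left|right].
  - by move=> z /one[G [[_ _ Gf] h _]]; exact: Gf.
exists (A `|` G0); split=> //= B lB AB.
have AB' : A `<=` B by apply: subset_trans AB => y; left.
have BG : B `|` G0 = B.
  by apply/seteqP; split=> y; [case=> // ?; apply: AB; right|left].
have [BA|nBA] := pselect (B `<=` A); first by move=> y /BA; left.
by case: (Amax B); [|rewrite BG].
Qed.

(** A maximal partial extension is total: for y outside its domain, the elements
    of R carrying y into the domain form an ideal, and the value q given by the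
    criterion is a legitimate image for y. *)
Lemma baer_extension : exists h : {linear N -> E}, forall x, h (f x) = g x.
Proof.
have [H [lH G0H Hmax]] := maximal_graph; have [H0 Hl Hf] := lH.
have tot y : exists z, H (y, z).
  pose I : set R := [set a | exists z, H (a *: y, z)].
  pose phi a : E := xget 0 [set z | H (a *: y, z)].
  have phiP a : I a -> H (a *: y, phi a) by exact: (@xgetPex _ 0 [set z | H (a *: y, z)]).
  have sI : ideal I.
    apply/submoduleP; split; first by exists 0; rewrite scale0r.
    move=> a b b' [z hz] [z' hz']; exists (a *: z + z').
    by have := Hl a _ _ _ _ hz hz'; rewrite scalerA -scalerDl.
  have [||q hq] := E_baer (phi := phi) sI.
  - move=> a b Ia Ib; apply: (linear_graph_fun lH); last first.
      by have := Hl 1 _ _ _ _ (phiP a Ia) (phiP b Ib); rewrite !scale1r -scalerDl; exact.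
    apply: phiP; have := (submoduleP _).1 sI => -[_ /(_ 1 _ _ Ia Ib)].
    by rewrite scale1r.
  - move=> a b Ib; apply: (linear_graph_fun lH); last first.
      by have := Hl a _ _ _ _ (phiP b Ib) H0; rewrite !addr0 scalerA; exact.
    by apply: phiP; have := (submoduleP _).1 sI => -[I0 /(_ a _ _ Ib I0)]; rewrite addr0.
  pose B : set (N * E) :=
    [set p | exists a y' z', H (y', z') /\ p = (y' + a *: y, z' + a *: q)].
  suff /(Hmax B) : linear_graph B.
    move=> BH; exists q; apply: BH.
      by move=> [u z] hu; exists 0, u, z; rewrite !scale0r !addr0.
    by exists 1, 0, 0; rewrite !scale1r !add0r.
  split; first by exists 0, 0, 0; rewrite !scale0r !addr0.
  - move=> a _ _ _ _ [b [u [w [hu [-> ->]]]]] [b' [u' [w' [hu' [-> ->]]]]].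
    exists (a * b + b'), (a *: u + u'), (a *: w + w'); split; first exact: Hl.
    by rewrite !scalerDr !scalerDl !scalerA; congr (_, _); rewrite addrACA.
  - move=> _ [a [u [w [hu [uE ->]]]]].
    have uE' : u = (- a) *: y by rewrite scaleNr; apply/eqP; rewrite -addr_eq0 -uE.
    have Ia : I (- a) by exists w; rewrite -uE'.
    have -> : w = (- a) *: q.
      by rewrite -hq //; apply: (linear_graph_fun lH hu); rewrite uE'; exact: phiP.
    by rewrite scaleNr addNr.
pose h y : E := xget 0 [set z | H (y, z)].
have hP y : H (y, h y) by exact: (@xgetPex _ 0 [set z | H (y, z)] (tot y)).
have hl : linear h.
  by move=> a y z; apply: (linear_graph_fun lH (hP _)); apply: Hl; exact: hP.
pose hL := GRing.isLinear.Build R N E *:%R h hl.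
pose h' : {linear N -> E} := HB.pack h hL.
exists h' => x; apply: (linear_graph_fun lH (hP _)).
by apply: G0H; exists x.
Qed.

End Extension.

Lemma baer_injective : baer -> injective_module E.
Proof. by move=> hE M N f g f_inj; exact: baer_extension. Qed.

End Baer.

Section FractionQuotient.
Variable R : idomainType.
Local Notation K := {fraction R}.

(** A homomorphism phi from an ideal to K is multiplication by phi(a) / a,
    whatever the nonzero element a of the ideal. *)
Lemma fraction_baer : baer (K : lmodType R).
Proof.
move=> I phi sI phiD phiM.
have [I0 Il] := (submoduleP _).1 sI.
have [[a [Ia a0]]|no] := pselect (exists a, I a /\ a != 0); last first.
  exists 0 => a Ia; have -> : a = 0.
    by apply/eqP; apply: contrapT => /negP a0; apply: no; exists a.
  by have := phiM 0 0 I0; rewrite mul0r !scale0r.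
have a0' : a%:F != 0 by rewrite tofrac_eq0.
exists (phi a / a%:F) => b Ib; apply: (mulfI a0').
have : a *: phi b = b *: phi a by rewrite -!phiM // mulrC.
by rewrite !fracZE => ->; rewrite [RHS]mulrCA [a%:F * _]mulrC divfK.
Qed.

Definition in_ringK : {pred K} := fun y => `[< ringK R y >].

Lemma in_ringK_zmod : zmod_closed in_ringK.
Proof.
split=> [|y z /asboolP Ry /asboolP Rz]; apply/asboolP.
  exact: submod0 (ringK_sub R).
by apply: submodB => //; exact: ringK_sub.
Qed.

HB.instance Definition _ := GRing.isZmodClosed.Build K in_ringK in_ringK_zmod.

Definition K_mod_R := Quotient.quot in_ringK.
HB.instance Definition _ := GRing.Zmodule.on K_mod_R.

Local Open Scope quotient_scope.

Definition toquot (y : K) : K_mod_R := \pi y.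

Lemma toquotB : {morph toquot : y z / y - z}.
Proof. by move=> y z; rewrite /toquot !piE. Qed.

Lemma toquotD : {morph toquot : y z / y + z}.
Proof. by move=> y z; rewrite /toquot !piE. Qed.

Lemma toquot_eq0 y : toquot y = 0 <-> ringK R y.
Proof.
have -> : 0 = toquot 0 by rewrite -{1}(subrr (toquot 0)) -toquotB subrr.
split=> [/eqP|Ry]; last apply/eqP; rewrite /toquot -Quotient.idealrBE subr0.
  by move/asboolP.
exact/asboolP.
Qed.

Lemma toquot_surj u : exists y, toquot y = u.
Proof. by exists (repr u); rewrite /toquot reprK. Qed.

Definition quot_scale (a : R) (u : K_mod_R) : K_mod_R := toquot (a%:F * repr u).

Lemma toquotZ a y : toquot (a%:F * y) = quot_scale a (toquot y).
Proof.
apply/eqP; rewrite -subr_eq0 -toquotB -mulrBr; apply/eqP/toquot_eq0.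
apply: submodM; first exact: ringK_sub.
apply/toquot_eq0; rewrite toquotB; apply/eqP; rewrite subr_eq0.
by rewrite /toquot reprK.
Qed.

Lemma quot_scaleA a b u : quot_scale a (quot_scale b u) = quot_scale (a * b) u.
Proof. by have [y <-] := toquot_surj u; rewrite -!toquotZ mulrA tofracM. Qed.

Lemma quot_scale1 : left_id 1 quot_scale.
Proof. by move=> u; have [y <-] := toquot_surj u; rewrite -!toquotZ tofrac1 mul1r. Qed.

Lemma quot_scaleDr : right_distributive quot_scale +%R.
Proof.
move=> a u w; have [y <-] := toquot_surj u; have [z <-] := toquot_surj w.
by rewrite -toquotD -!toquotZ mulrDr toquotD.
Qed.

Lemma quot_scaleDl u : {morph quot_scale^~ u : a b / a + b}.
Proof.
by move=> a b; have [y <-] := toquot_surj u; rewrite -!toquotZ tofracD mulrDl toquotD.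
Qed.

HB.instance Definition _ := GRing.Zmodule_isLmodule.Build R K_mod_R
  quot_scaleA quot_scale1 quot_scaleDr quot_scaleDl.

Lemma scale_toquot a y : a *: toquot y = toquot (a%:F * y).
Proof. by rewrite toquotZ. Qed.

Lemma toquot_linear : linear (toquot : (K : lmodType R) -> K_mod_R).
Proof. by move=> a y z; rewrite toquotD fracZE toquotZ. Qed.

HB.instance Definition _ := GRing.isLinear.Build R K K_mod_R *:%R toquot
  toquot_linear.

Lemma tofrac_linear : linear (@tofrac R : R^o -> K).
Proof. by move=> a y z; rewrite tofracD tofracM. Qed.

(** The resolution is 0 -> R -> K -> K / R -> 0. *)
Lemma quot_baer_gorenstein : baer (K_mod_R : lmodType R) -> gorenstein R.
Proof.
move=> hC; exists 1%N; exists (K : lmodType R), (K_mod_R : lmodType R).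
pose iL := GRing.isLinear.Build R R^o K *:%R (@tofrac R : R^o -> K) tofrac_linear.
pose i : {linear R^o -> K} := HB.pack (@tofrac R : R^o -> K) iL.
exists i, (toquot : {linear K -> K_mod_R}); split.
- exact/baer_injective/fraction_baer.
- by move=> a b /= /eqP; rewrite tofrac_eq => /eqP.
- exact: toquot_surj.
- move=> y; split=> [/toquot_eq0[a _ <-]|[a <-]]; first by exists a.
  by apply/toquot_eq0; exact: ringK_mem.
- exact: baer_injective.
Qed.

End FractionQuotient.

(** * Numerical semigroups *)

Section NumericalSemigroup.
Local Open Scope nat_scope.

(** What the classification uses about R: S is the value semigroup, T the set of
    values of R : m, c the conductor, n the number of elements of S below c, r
    the type, l the length of R modulo the conductor and x, and d the length of
    Rbar / R. *)
Record semigroup_data (S T : pred nat) (c e p n r l d : nat) : Prop := {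
  sg_S_0 : S 0;
  sg_S_D : forall k k', S k -> S k' -> S (k + k');
  sg_S_ge : forall k, c <= k -> S k;
  sg_S_pred : ~~ S c.-1;
  sg_S_e : S e;
  sg_S_min : forall k, 0 < k -> S k -> e <= k;
  sg_T_S : forall k s, T k -> S s -> 0 < s -> S (k + s);
  sg_S_T : forall k, S k -> T k;
  sg_T_ge : forall k, c <= k + e -> T k;
  sg_p_bounds : c - e <= p * e < c;
  sg_p_gt0 : 0 < p;
  sg_nE : n = count S (iota 0 c);
  sg_rE : r + n = count T (iota 0 c);
  sg_lE : l + count S (iota 0 (c - e)) = n;
  sg_dE : d + n = c;
  sg_d_le : forall k j, k <= c <= k + j -> 0 < j ->
    d <= r * count S (iota 0 k) + j.-1;
  sg_small : forall w, S w -> e <= w -> ~~ T (w - e) -> exists w',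
    [/\ S w', 0 < w' < c, ~~ ((e <= w') && S (w' - e)) & w + w' < c + e]
}.

Section Combinatorics.
Variables (S T : pred nat) (c e p n r l d : nat).
Hypothesis data : semigroup_data S T c e p n r l d.

Let S_0 : S 0.
Proof. by case: data. Qed.
Let S_D : forall k k', S k -> S k' -> S (k + k').
Proof. by case: data. Qed.
Let S_ge : forall k, c <= k -> S k.
Proof. by case: data. Qed.
Let S_pred : ~~ S c.-1.
Proof. by case: data. Qed.
Let S_e : S e.
Proof. by case: data. Qed.
Let S_min : forall k, 0 < k -> S k -> e <= k.
Proof. by case: data. Qed.
Let T_S : forall k s, T k -> S s -> 0 < s -> S (k + s).
Proof. by case: data. Qed.
Let S_T : forall k, S k -> T k.
Proof. by case: data. Qed.
Let T_ge : forall k, c <= k + e -> T k.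
Proof. by case: data. Qed.
Let p_bounds : c - e <= p * e < c.
Proof. by case: data. Qed.
Let p_gt0 : 0 < p.
Proof. by case: data. Qed.
Let nE : n = count S (iota 0 c).
Proof. by case: data. Qed.
Let rE : r + n = count T (iota 0 c).
Proof. by case: data. Qed.
Let lE : l + count S (iota 0 (c - e)) = n.
Proof. by case: data. Qed.
Let dE : d + n = c.
Proof. by case: data. Qed.
Let d_le : forall k j, k <= c <= k + j -> 0 < j ->
  d <= r * count S (iota 0 k) + j.-1.
Proof. by case: data. Qed.
Let small : forall w, S w -> e <= w -> ~~ T (w - e) -> exists w',
  [/\ S w', 0 < w' < c, ~~ ((e <= w') && S (w' - e)) & w + w' < c + e].
Proof. by case: data. Qed.

Lemma mult_gt0 : 0 < e.
Proof.
by move: p_bounds; case: e => //; rewrite muln0; case: c.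
Qed.

Lemma mult_lt_c : e < c.
Proof.
have := p_bounds; have := p_gt0; case: (p) => // q _; rewrite mulSn; lia.
Qed.

Lemma S_mult i : S (i * e).
Proof. by elim: i => [//|i IH]; rewrite mulSn; apply: S_D. Qed.

Lemma S_addmult k i : S k -> S (k + i * e).
Proof. by move=> Sk; apply: S_D => //; exact: S_mult. Qed.

(** Turns an explicit description of a set into its number of elements. *)
Lemma count_list (P : pred nat) a w (L : seq nat) : uniq L ->
  (forall k, (k \in L) = (a <= k < a + w) && P k) -> count P (iota a w) = size L.
Proof.
move=> uL h; rewrite -size_filter; apply/perm_size/uniq_perm => //.
  by apply: filter_uniq; exact: iota_uniq.
by move=> k; rewrite mem_filter mem_iota h andbC.
Qed.

Lemma l_window : l = count S (iota (c - e) e).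
Proof.
have := lE; rewrite nE; have {2}-> : c = (c - e) + e by have := mult_lt_c; lia.
by rewrite iotaD count_cat add0n; lia.
Qed.

(** Elements of T outside S are pairwise incongruent mod e: adding a positive
    multiple of e to an element of T gives an element of S. *)
Lemma type_le_size (L : seq nat) :
  (forall z, z < c -> T z -> ~~ S z -> z %% e \in L) -> r <= size L.
Proof.
move=> hL; pose G := [seq z <- iota 0 c | T z && ~~ S z].
have sG : size G = r.
  have h : count (predI S T) (iota 0 c) + count (predI (predC S) T) (iota 0 c) =
      count T (iota 0 c).
    by rewrite -!count_filter count_predC size_filter.
  have := rE; rewrite nE /G size_filter.
  have -> : count S (iota 0 c) = count (predI S T) (iota 0 c).
    by apply: eq_count => z /=; case Sz: (S z) => //=; rewrite S_T.
  have -> : count (fun z => T z && ~~ S z) (iota 0 c) = count (predI (predC S) T) (iota 0 c).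
    by apply: eq_count => z /=; rewrite andbC.
  by move: h; lia.
rewrite -sG -(size_map (modn^~ e)); apply: uniq_leq_size.
  rewrite map_inj_in_uniq; first by apply: filter_uniq; exact: iota_uniq.
  have wlg z z' : z \in G -> z' \in G -> z %% e = z' %% e -> z <= z'.
    rewrite !mem_filter => /andP[/andP[Tz nSz] _] /andP[/andP[Tz' _] _] zz.
    rewrite leqNgt; apply/negP => lt; case/negP: nSz.
    have -> : z = z' + (z %/ e - z' %/ e) * e.
      have : z' %/ e * e <= z %/ e * e by rewrite leq_mul2r leq_div2r ?orbT // ltnW.
      by rewrite mulnBl; move: (divn_eq z e) (divn_eq z' e); rewrite zz; lia.
    apply: T_S => //; first exact: S_mult.
    rewrite muln_gt0 mult_gt0 andbT subn_gt0; apply: contraLR lt.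
    rewrite -!leqNgt => h; rewrite (divn_eq z e) (divn_eq z' e) zz leq_add2r.
    by rewrite leq_mul2r h orbT.
  by move=> z z' Gz Gz' zz; apply/eqP; rewrite eqn_leq !wlg.
move=> _ /mapP[z + ->]; rewrite mem_filter mem_iota => /andP[/andP[Tz nSz] zc].
exact: hL.
Qed.

(** The class of 0 is excluded, since it is contained in S. *)
Lemma type_le : r <= e.-1.
Proof.
rewrite -(size_iota 1 e.-1); apply: type_le_size => z zc Tz nSz.
have e0 := mult_gt0; rewrite mem_iota add1n prednK // ltn_mod e0 andbT lt0n.
by apply: contra nSz => /eqP zE; rewrite (divn_eq z e) zE addn0; exact: S_mult.
Qed.

Lemma type_le_avoid u : 0 < u < e ->
  (forall z, z < c -> T z -> ~~ S z -> z %% e != u) -> r <= e - 2.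
Proof.
move=> /andP[u0 ue] hu; have -> : e - 2 = size (rem u (iota 1 e.-1)).
  rewrite size_rem ?size_iota; first by lia.
  by rewrite mem_iota; lia.
apply: type_le_size => z zc Tz nSz; rewrite mem_rem_uniq ?iota_uniq //.
have e0 := mult_gt0; rewrite inE /= hu // mem_iota add1n prednK // ltn_mod e0 andbT lt0n.
by apply: contra nSz => /eqP zE; rewrite (divn_eq z e) zE addn0; exact: S_mult.
Qed.

Lemma countT_tail : count T (iota (c - e) e) = e.
Proof.
rewrite (@eq_in_count _ _ predT) ?count_predT ?size_iota // => k.
by rewrite mem_iota => hk; apply: T_ge; lia.
Qed.

(** All of [c - e, c) lies in T, and l of these e integers lie in S. *)
Lemma type_ge : e <= r + l.
Proof.
have := rE; have {1}-> : c = (c - e) + e by have := mult_lt_c; lia.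
rewrite iotaD count_cat add0n countT_tail.
have := sub_count S_T (iota 0 (c - e)); have := lE; lia.
Qed.

Lemma type_gt z : z < c - e -> T z -> ~~ S z -> e < r + l.
Proof.
move=> zc Tz nSz.
have := rE; have {1}-> : c = (c - e) + e by have := mult_lt_c; lia.
rewrite iotaD count_cat add0n countT_tail.
suff : count S (iota 0 (c - e)) < count T (iota 0 (c - e)) by have := lE; lia.
have -> : c - e = z + (1 + (c - e - z.+1)) by lia.
rewrite !iotaD !count_cat /= Tz (negPf nSz).
have h := sub_count S_T.
by have := h (iota 0 z); have := h (iota (0 + z + 1) (c - e - z.+1)); lia.
Qed.

(** The bound on d taken at c - e, where j = e. *)
Lemma tail_bound : d + r * l <= r * n + e.-1.
Proof.
have ec := mult_lt_c; have e0 := mult_gt0.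
have := d_le (k := c - e) (j := e).
rewrite leq_subr subnK ?(ltnW ec) // leqnn => /(_ isT e0).
by rewrite -lE mulnDr; lia.
Qed.

(** The window [c - e, c) contains c - 1, which is not in S. *)
Lemma l_lt_e : l < e.
Proof.
have e0 := mult_gt0; have ec := mult_lt_c; rewrite l_window.
rewrite -{2}(prednK e0) -(addn1 e.-1) iotaD count_cat /=; have -> : c - e + e.-1 = c.-1 by lia.
rewrite (negPf S_pred); have := count_size S (iota (c - e) e.-1).
by rewrite size_iota; lia.
Qed.

Lemma type_gt0 : 0 < r.
Proof. by have := type_ge; have := l_lt_e; lia. Qed.

Lemma l_gt0 : 0 < l.
Proof.
rewrite l_window -has_count; apply/hasP; exists (p * e); last exact: S_mult.
by rewrite mem_iota; have := mult_lt_c; lia.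
Qed.

(** The conductor is determined by S, as c - 1 is not in S. *)
Lemma c_eq_of_list (L : seq nat) c' : (forall k, S k = (k \in L) || (c' <= k)) ->
  0 < c' -> c'.-1 \notin L -> c = c'.
Proof.
move=> h c0 nL; apply/eqP; rewrite eqn_leq.
apply/andP; split; rewrite leqNgt; apply/negP => lt.
  by case/negP: S_pred; rewrite h; apply/orP; right; lia.
have : S c'.-1 by apply: S_ge; lia.
by rewrite h (negPf nL) /=; lia.
Qed.

Definition multiples : seq nat := [seq i * e | i <- iota 0 p.+1].

(** The part below the conductor of a residue class mod e. *)
Definition run w q : seq nat := [seq w + i * e | i <- iota 0 q].

Lemma runP w q k : reflect (exists2 i, i < q & k = w + i * e) (k \in run w q).
Proof.
apply: (iffP mapP) => [[i + ->]|[i iq ->]].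
  by rewrite mem_iota => /andP[_ iq]; exists i.
by exists i => //; rewrite mem_iota.
Qed.

Lemma multiplesE : multiples = run 0 p.+1.
Proof. by []. Qed.

Lemma run_uniq w q : uniq (run w q).
Proof.
rewrite map_inj_uniq ?iota_uniq // => i j /addnI /eqP.
by rewrite eqn_pmul2r ?mult_gt0 // => /eqP.
Qed.

(** Every element of S below c is carried into the window [c - e, c) by adding a
    multiple of e, so S is described by the elements of the window. *)
Lemma to_window k : k < c -> exists i, c - e <= k + i * e < c.
Proof.
move=> kc; have e0 := mult_gt0.
have ex : exists i, c - e <= k + i * e by exists c; have : c <= c * e := leq_pmulr c e0; lia.
case: (ex_minnP ex) => i hi imin; exists i; rewrite hi /=.
case: i hi imin => [|i] hi imin; first by rewrite addn0.
rewrite ltnNge; apply/negP => h.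
have /imin : c - e <= k + i * e by move: h; rewrite mulSn; lia.
by rewrite ltnn.
Qed.

(** The only element of S in the window is then p e. *)
Lemma shape1 : l = 1 -> forall k, S k = (k \in multiples) || (c <= k).
Proof.
move=> l1 k; have [ck|kc] := leqP c k; first by rewrite orbT; exact: S_ge.
rewrite orbF multiplesE; apply/idP/runP => [Sk|[i _ ->]]; last exact: S_mult.
have [i hi] := to_window kc.
have : size [seq k <- iota (c - e) e | S k] = 1 by rewrite size_filter -l_window.
case E: [seq _ <- _ | _] => [|u [|]] // _.
have : k + i * e \in [:: u].
  by rewrite -E mem_filter mem_iota S_addmult //; have := mult_lt_c; lia.
have : p * e \in [:: u].
  by rewrite -E mem_filter mem_iota S_mult //; have := mult_lt_c; lia.
rewrite !inE => /eqP <- /eqP pE.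
have ip : i <= p by rewrite -(leq_pmul2r mult_gt0); lia.
by exists (p - i); [lia|rewrite mulnBl; lia].
Qed.

Lemma shape1_l : (forall k, S k = (k \in multiples) || (c <= k)) -> l = 1.
Proof.
move=> h; rewrite l_window (count_list (L := [:: p * e])) // => k; rewrite inE.
have ec := mult_lt_c; have e0 := mult_gt0; rewrite h multiplesE.
apply/eqP/andP => [->|[hk /orP[/runP[i ip kE]|]]]; last by lia.
  split; first by lia.
  by apply/orP; left; apply/runP; exists p.
move: hk; rewrite kE add0n => hk; congr (_ * _); apply/eqP; rewrite eqn_leq -ltnS ip /=.
rewrite leqNgt; apply/negP => lt.
have : i.+1 * e <= p * e by rewrite leq_pmul2r.
by rewrite mulSn; lia.
Qed.

Lemma shape1_n : l = 1 -> n = p.+1.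
Proof.
move=> /shape1 h; rewrite nE (count_list (L := multiples)).
- by rewrite size_map size_iota.
- by rewrite multiplesE; exact: run_uniq.
- move=> k; rewrite h /=; apply/idP/andP => [hk|[kc /orP[//|]]]; last by lia.
  rewrite hk; split=> //; move: hk; rewrite multiplesE => /runP[i ip ->].
  have : i * e <= p * e by rewrite leq_pmul2r ?mult_gt0 // -ltnS.
  by lia.
Qed.

Lemma shape1_r : l = 1 -> r = e.-1.
Proof. by have := type_ge; have := type_le; lia. Qed.

(** Descend from u by steps of e as long as S permits; w is the place where this
    stops. *)
Lemma class_run u : c - e <= u < c -> S u -> u != p * e -> exists w q,
  [/\ u = w + q * e, e < w /\ w %% e != 0, S w, ~~ S (w - e) &
      forall k i, S k -> k + i * e = u -> k \in run w q.+1].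
Proof.
move=> hu Su uN; have e0 := mult_gt0; have ec := mult_lt_c.
pose Q j := (j * e <= u) && S (u - j * e).
have Qb j : Q j -> j <= u.
  by case/andP=> ju _; apply: leq_trans ju; rewrite leq_pmulr.
have Q0 : exists j, Q j by exists 0; rewrite /Q mul0n subn0 Su.
case: (ex_maxnP Q0 Qb) => q /andP[qu Sw] qmax.
have wN i : u - q * e != i * e.
  apply/eqP => wE; case/eqP: uN; have uE : u = (i + q) * e by rewrite mulnDl -wE subnK.
  rewrite uE; congr (_ * e); apply/eqP; rewrite eqn_leq.
  apply/andP; split; rewrite leqNgt; apply/negP => lt.
    have : p.+1 * e <= (i + q) * e by rewrite leq_pmul2r.
    by rewrite mulSn; lia.
  have : (i + q).+1 * e <= p * e by rewrite leq_pmul2r.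
  by rewrite mulSn; lia.
have we : e < u - q * e.
  have w1 := wN 1; have w0 := wN 0; rewrite mul1n in w1; rewrite mul0n in w0.
  have : e <= u - q * e by apply: S_min => //; rewrite lt0n.
  by lia.
exists (u - q * e), q; split=> //; first by rewrite subnK.
  split=> //; apply/negP => /eqP w0; have := wN ((u - q * e) %/ e).
  by rewrite {1}(divn_eq (u - q * e) e) w0 addn0 eqxx.
  apply/negP => h; have : Q q.+1.
    rewrite /Q mulSn; apply/andP; split; first by lia.
    by have -> : u - (e + q * e) = u - q * e - e by lia.
  by move/qmax; rewrite ltnn.
move=> k i Sk ki; have iq : i <= q.
  by apply: qmax; rewrite /Q -ki leq_addl addnK.
have iqe : i * e <= q * e by rewrite leq_pmul2r.
by apply/runP; exists (q - i); [rewrite ltnS leq_subr|rewrite mulnBl; lia].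
Qed.

Lemma run_disjoint w q w' q' : w %% e != w' %% e -> ~~ has (mem (run w q)) (run w' q').
Proof.
move=> ne; apply/hasPn => k /runP[i _ ->]; apply/negP => /runP[j _].
by move/(congr1 (modn^~ e)); rewrite ![_ + _ * e]addnC !modnMDl => h; case/negP: ne; rewrite h.
Qed.

Lemma window_list : exists L, [/\ size L = l.-1, uniq L, p * e \notin L,
  forall u, u \in L -> c - e <= u < c /\ S u &
  forall k, c - e <= k < c -> S k -> k = p * e \/ k \in L].
Proof.
have ec := mult_lt_c; pose F := [seq k <- iota (c - e) e | S k].
have uF : uniq F by apply: filter_uniq; exact: iota_uniq.
have memF k : (k \in F) = (c - e <= k < c) && S k.
  by rewrite mem_filter mem_iota andbC; congr (_ && _); lia.
exists (rem (p * e) F); split.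
- by rewrite size_rem ?size_filter -?l_window // memF p_bounds S_mult.
- exact: rem_uniq.
- by rewrite mem_rem_uniq // inE /= eqxx.
- by move=> u /mem_rem; rewrite memF => /andP.
- move=> k hk Sk; have [->|kN] := eqVneq k (p * e); [by left|right].
  by rewrite mem_rem_uniq // inE /= kN memF hk.
Qed.

Lemma mult_of_window k i : k + i * e = p * e -> k \in multiples.
Proof.
move=> ki; have ip : i <= p by rewrite -(leq_pmul2r mult_gt0); lia.
by rewrite multiplesE; apply/runP; exists (p - i); [lia|rewrite mulnBl; lia].
Qed.

Lemma mult_S k : k \in multiples -> k < c /\ S k.
Proof.
rewrite multiplesE => /runP[i ip ->]; split; last exact: S_mult.
have : i * e <= p * e by rewrite leq_pmul2r ?mult_gt0 // -ltnS.
by lia.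
Qed.

Lemma run_S w q k : S w -> w + q * e < c -> k \in run w q.+1 -> k < c /\ S k.
Proof.
move=> Sw hw /runP[i iq ->]; split; last exact: S_addmult.
have : i * e <= q * e by rewrite leq_pmul2r ?mult_gt0 // -ltnS.
by lia.
Qed.

Lemma shape2 : l = 2 -> exists w q,
  [/\ e < w, S w, ~~ S (w - e), w + q * e < c <= w + q * e + e &
      n = p.+1 + q.+1 /\
      forall k, S k = [|| k \in multiples, k \in run w q.+1 | c <= k]].
Proof.
move=> l2; have [L [sL uL _ Lwin winL]] := window_list.
move: sL; rewrite l2; case: L uL Lwin winL => [|u [|]] // _ Lwin winL _.
have [hu Su] := Lwin u (mem_head _ _).
have [uN|uN] := eqVneq u (p * e).
  have := l_window; rewrite l2 (count_list (L := [:: p * e])) // => k; rewrite inE.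
  have ec := mult_lt_c; apply/eqP/andP => [->|[hk Sk]]; first by split; [lia|exact: S_mult].
  by case: (winL k _ Sk); rewrite ?inE; lia.
have [w [q [uE [ew w0] Sw nSw urun]]] := class_run hu Su uN.
have wc : w + q * e < c by rewrite -uE; case/andP: hu.
have hS k : S k = [|| k \in multiples, k \in run w q.+1 | c <= k].
  apply/idP/or3P => [Sk|[/mult_S[]//|/(run_S Sw wc)[]//|/S_ge//]].
  have [ck|kc] := leqP c k; first by constructor 3.
  have [i hi] := to_window kc; have [kE|] := winL _ hi (S_addmult i Sk).
    by constructor 1; exact: mult_of_window kE.
  by rewrite inE => /eqP /(urun _ _ Sk); constructor 2.
exists w, q; split=> //; first by have := mult_lt_c; lia.
split=> //; rewrite nE (count_list (L := multiples ++ run w q.+1)).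
- by rewrite size_cat !size_map !size_iota.
- rewrite cat_uniq multiplesE !run_uniq andTb andbT.
  by apply: run_disjoint; rewrite mod0n eq_sym.
- move=> k; rewrite mem_cat hS /=; have [kc|ck] := ltnP k c; first by rewrite orbF.
  by apply/negbTE/negP => /orP[/mult_S[]|/(run_S Sw wc)[]]; rewrite ltnNge ck.
Qed.

Lemma shape3 : l = 3 -> exists w q w' q',
  [/\ [/\ e < w, S w, ~~ S (w - e) & w + q * e < c <= w + q * e + e],
      [/\ e < w', S w', ~~ S (w' - e) & w' + q' * e < c <= w' + q' * e + e],
      [/\ w < w', w %% e != 0, w' %% e != 0 & w %% e != w' %% e],
      n = p.+1 + q.+1 + q'.+1 &
      forall k, S k = [|| k \in multiples, k \in run w q.+1, k \in run w' q'.+1 | c <= k]].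
Proof.
move=> l3; have [L [sL uL nL Lwin winL]] := window_list.
move: sL; rewrite l3; case: L uL nL Lwin winL => [|u [|u' [|]]] //= uL nL Lwin winL _.
move: nL uL; rewrite !inE !negb_or !andbT ![p * e == _]eq_sym => /andP[uN uN'] uu.
have [hu Su] := Lwin u (mem_head _ _).
have [hu' Su'] : c - e <= u' < c /\ S u' by apply: Lwin; rewrite !inE eqxx orbT.
have ec := mult_lt_c; have e0 := mult_gt0.
have [w [q [uE [ew w0] Sw nSw urun]]] := class_run hu Su uN.
have [w' [q' [uE' [ew' w0'] Sw' nSw' urun']]] := class_run hu' Su' uN'.
have ww : w %% e != w' %% e.
  apply: contra uu => /eqP we; have : u = u' %[mod e].
    by rewrite uE uE' ![_ + _ * e]addnC !modnMDl.
  wlog lt : u u' hu hu' {Lwin winL uN uN' Su Su' uE uE' urun urun'} / u <= u'.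
    move=> H uu; have [lt|/ltnW lt] := leqP u u'; first exact: H.
    by rewrite eq_sym; apply: H.
  clear w0 w0'; move=> /esym/eqP; rewrite eqn_mod_dvd // => /dvdnP[[|i]]; first by lia.
  by rewrite mulSn; lia.
have wc : w + q * e < c by rewrite -uE; case/andP: hu.
have wc' : w' + q' * e < c by rewrite -uE'; case/andP: hu'.
have hS k : S k = [|| k \in multiples, k \in run w q.+1, k \in run w' q'.+1 | c <= k].
  apply/idP/or4P => [Sk|[/mult_S[]//|/(run_S Sw wc)[]//|/(run_S Sw' wc')[]//|/S_ge//]].
  have [ck|kc] := leqP c k; first by constructor 4.
  have [i hi] := to_window kc; have [kE|] := winL _ hi (S_addmult i Sk).
    by constructor 1; exact: mult_of_window kE.
  rewrite !inE => /orP[] /eqP; first by move/(urun _ _ Sk); constructor 2.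
  by move/(urun' _ _ Sk); constructor 3.
have hn : n = p.+1 + q.+1 + q'.+1.
  rewrite nE (count_list (L := multiples ++ run w q.+1 ++ run w' q'.+1)).
  - by rewrite !size_cat !size_map !size_iota addnA.
  - rewrite !cat_uniq multiplesE !run_uniq has_cat negb_or !andTb !andbT.
    by rewrite !run_disjoint // mod0n eq_sym.
  - move=> k; rewrite !mem_cat hS /=; have [kc|ck] := ltnP k c; first by rewrite orbF.
    by apply/negbTE/negP => /or3P[/mult_S[]|/(run_S Sw wc)[]|/(run_S Sw' wc')[]];
      rewrite ltnNge ck.
have win : w + q * e < c <= w + q * e + e.
  by rewrite wc -uE addnC -leq_subLR; case/andP: hu.
have win' : w' + q' * e < c <= w' + q' * e + e.
  by rewrite wc' -uE' addnC -leq_subLR; case/andP: hu'.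
have [lt|lt|wE] := ltngtP w w'.
- by exists w, q, w', q'; split=> //; split.
- exists w', q', w, q; split=> //; first by split=> //; rewrite eq_sym.
  + by rewrite hn addnAC.
  + by move=> k; rewrite hS; congr (_ || _); rewrite orbCA.
- by move: ww; rewrite wE eqxx.
Qed.

(** Only the first term w of a progression w + i e in S can fail to lie in e +
    S. *)
Lemma apery_run w i : S w -> ~~ ((e <= w + i * e) && S (w + i * e - e)) -> i = 0.
Proof.
case: i => // i Sw; rewrite mulSn addnCA leq_addr /= addKn => /negP[].
exact: S_addmult.
Qed.

(** If r = e - l then T has nothing new below c - e, so w - e is outside T. *)
Lemma small_apery w : r + l = e -> S w -> e <= w < c -> ~~ S (w - e) -> exists w',
  [/\ S w', 0 < w' < c, ~~ ((e <= w') && S (w' - e)) & w + w' < c + e].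
Proof.
move=> rl Sw /andP[ew wc] nSw; apply: small => //; apply/negP => Tw.
by have := type_gt _ Tw nSw; lia.
Qed.

(** The element w' associated with w must be w itself, the multiples of e being
    excluded. *)
Lemma small2 w q : r + l = e -> e < w < c -> S w -> ~~ S (w - e) ->
  (forall k, S k = [|| k \in multiples, k \in run w q.+1 | c <= k]) ->
  2 * w < c + e.
Proof.
move=> rl hw Sw nSw hS; have [|w' [Sw' hw' nw' lt]] := small_apery rl Sw _ nSw; first by lia.
move: Sw'; rewrite hS multiplesE => /or3P[/runP[i _ wE]|/runP[i _ wE]|]; last by lia.
- by have := @apery_run 0 i S_0; rewrite -wE => /(_ nw') i0; move: hw'; rewrite wE i0; lia.
- by have := @apery_run w i Sw; rewrite -wE => /(_ nw') i0; move: lt; rewrite wE i0; lia.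
Qed.

(** Applied to the larger element w', where the partner is w or w'. *)
Lemma small3 w q w' q' : r + l = e -> e < w < c -> e < w' < c -> S w -> S w' ->
  ~~ S (w' - e) -> w < w' ->
  (forall k, S k = [|| k \in multiples, k \in run w q.+1, k \in run w' q'.+1 | c <= k]) ->
  w + w' < c + e.
Proof.
move=> rl hw hw' Sw Sw' nSw' ww hS.
have [|z [Sz hz nz lt]] := small_apery rl Sw' _ nSw'; first by lia.
move: Sz; rewrite hS multiplesE.
case/or4P=> [/runP[i _ zE]|/runP[i _ zE]|/runP[i _ zE]|]; last by lia.
- by have := @apery_run 0 i S_0; rewrite -zE => /(_ nz) i0; move: hz; rewrite zE i0; lia.
- by have := @apery_run w i Sw; rewrite -zE => /(_ nz) i0; move: lt; rewrite zE i0; lia.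
- by have := @apery_run w' i Sw'; rewrite -zE => /(_ nz) i0; move: lt; rewrite zE i0; lia.
Qed.

(** * Value semigroups with small b *)

Local Notation f := (r * n + n).

(** With b + c = r n + n this says that b >= r l - (e - 1). *)
Lemma excess : r * l + c + 1 <= f + e.
Proof. by have := tail_bound; have := dE; have := mult_gt0; lia. Qed.

(** As e <= r + l, the previous bound gives b >= (r - 1)(l - 1). Since b + c = r
    n + n, the assumptions below of the form r n + n + 1 < c + r, r n + n + 1 =
    c + r and r n + n = c + r stand for b < r - 1, b = r - 1 and b = r. *)
Lemma excess_prod : (r.-1 * l.-1) + c <= f.
Proof.
have := excess; have := type_ge; have := l_gt0; have := type_gt0.
case: (r) => // r'; case: (l) => // l'; rewrite !mulSn !mulnS /=.
set a := r' * n; set a' := r' * l'; lia.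
Qed.

Lemma rnn_of_l1 : l = 1 -> f = e * p + e.
Proof.
move=> l1; rewrite (shape1_n l1) (shape1_r l1); have := mult_gt0.
by case: (e) => // e' _ /=; rewrite mulnS mulSn; lia.
Qed.

Lemma c_gt1_l1 : l = 1 -> p * e + 1 < c.
Proof.
move=> l1; have /andP[_ pc] := p_bounds.
rewrite ltn_neqAle addn1 pc andbT; apply/eqP => cE.
by case/negP: S_pred; rewrite -cE; exact: S_mult.
Qed.

Hypothesis r_gt1 : 1 < r.

Lemma l1_of_small_b : f + 1 < c + r -> l = 1.
Proof.
have := excess_prod; have := l_gt0; have := r_gt1.
case: (l) => [|[|l']] //= r1 _; rewrite mulnS; set a := _ * l'; set g := f; lia.
Qed.

Lemma l_le2_of_b : f + 1 = c + r -> l <= 2.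
Proof.
have := excess_prod; have := l_gt0; have := r_gt1.
case: (l) => [|[|[|l']]] //= r1 _; rewrite !mulnS; set a := _ * l'; set g := f; lia.
Qed.

Lemma l_le3_of_b : f = c + r -> l <= 3 /\ (l = 3 -> r = 2).
Proof.
have := excess_prod; have := l_gt0; have := r_gt1.
case: (l) => [|[|[|[|l']]]] //= r1 _; rewrite !mulnS; set a := _ * _; set g := f; lia.
Qed.

Lemma r_of_b_pred : f + 1 = c + r -> (l = 1 /\ r + 1 = e) \/ (l = 2 /\ r + 2 = e).
Proof.
move=> fE; have := l_le2_of_b fE; have := l_gt0; have := excess; have := type_ge.
rewrite -(ltnS 1) => h1 h2 h3 h4; have [l1|l2] : l = 1 \/ l = 2 by lia.
  by left; split=> //; have := shape1_r l1; have := mult_gt0; lia.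
by right; split=> //; move: h1 h2; rewrite l2; set a := r * n in fE *; lia.
Qed.

(** The case l = 1 would give c = p e + 1, so that c - 1 would be in S. The case
    l = 2 with r = e - 1 would give c = 1 + (n - 1) e, which exceeds (p + 1) e. *)
Lemma r_of_b_type : f = c + r -> (l = 2 /\ r + 2 = e) \/ [/\ l = 3, r = 2 & e = 5].
Proof.
move=> fE; have [l3 lr] := l_le3_of_b fE; have := l_gt0; have := excess; have := type_ge.
move=> h1 h2 h3; have [l1|[l2|l3']] : l = 1 \/ l = 2 \/ l = 3 by lia.
- have := rnn_of_l1 l1; have := c_gt1_l1 l1; have := shape1_r l1; have := mult_gt0.
  by rewrite fE; lia.
- left; split=> //; have rle := type_le; move: h1 h2; rewrite l2 => h1 h2.
  suff : r + 1 != e by set a := r * n in fE h2 *; lia.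
  apply/eqP => re; have [w [q [ew _ _ wc [nE' _]]]] := shape2 l2.
  move: fE wc; rewrite nE' -re => fE wc; have /andP[_ pc] := p_bounds.
  have qc : (p + q).+1 * e < c by rewrite -re; move: fE; rewrite !mulnDr !mulnS; lia.
  have : p.+1 * e <= (p + q).+1 * e by rewrite leq_pmul2r ?mult_gt0 // ltnS leq_addr.
  have := p_bounds.
  by rewrite mulSn; lia.
- right; split=> //; first exact: lr.
  move: h1 h2; rewrite l3' (lr l3') => h1 h2; move: fE h2; rewrite (lr l3').
  by set a := 2 * n; lia.
Qed.

Lemma count_shape (L : seq nat) c' a : (forall k, S k = (k \in L) || (c' <= k)) ->
  uniq L -> a <= c' -> all (fun k => k < c') L ->
  count S (iota a (c' - a)) = count (leq a) L.
Proof.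
move=> h uL ac aL; rewrite (count_list (L := [seq k <- L | a <= k])) ?filter_uniq //.
  by rewrite size_filter.
move=> k; rewrite mem_filter h subnKC //.
have [kL|kL] /= := boolP (k \in L); first by rewrite (allP aL k kL) !andbT.
by lia.
Qed.

(** Here g = 1 stands for b = r - 1 and g = 0 for b = r. Eliminating w between 2
    w < c + e and c <= w + (q + 1) e bounds c, hence p, from above in terms of
    q, while c <= (p + 1) e bounds p from below; only q <= 2 survives. *)
Lemma bounds_l2 g : l = 2 -> r + 2 = e -> f + g = c + r -> exists w q,
  [/\ [/\ e < w /\ w != 2 * e, 2 * w < c + e, w + q * e < c <= w + q * e + e & 4 <= e],
      c + p + q = p * e + q * e + e + g, p <= 2 * q + 2, q + g <= 2 &
      forall k, S k = [|| k \in multiples, k \in run w q.+1 | c <= k]].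
Proof.
move=> l2 re fg; have [w [q [ew Sw nSw wc [nE' hS]]]] := shape2 l2.
have rl : r + l = e by rewrite l2.
have wb : e < w < c by rewrite ew; lia.
have w2 := small2 rl wb Sw nSw hS.
have e4 : 4 <= e by have := r_gt1; lia.
have cE : c + p + q = p * e + q * e + e + g.
  move: fg; rewrite nE' -re !mulnDr !mulnS.
  by rewrite (mulnC p r) (mulnC q r); set a := r * p; set a' := r * q; lia.
have /andP[_ pc] := p_bounds.
have pq : p <= 2 * q + 2.
  rewrite -ltnS -(ltn_pmul2r mult_gt0) mulSn mulnDl -mulnA; move: wc pc.
  by set P := p * e; set Q := q * e; lia.
have qe : q * 4 <= q * e by rewrite leq_mul2l e4 orbT.
have qg : q + g <= 2.
  have := p_bounds; move: cE qe; set P := p * e; set Q := q * e; lia.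
exists w, q; split=> //; split=> //; split=> //; apply: contra nSw => /eqP ->.
by have -> : 2 * e - e = e by lia.
Qed.

(** By the preceding bounds q = 0 and p is 1 or 2. *)
Lemma shapes_b_pred : r + 2 = e -> f + 1 = c + r ->
  (forall k, S k = (k \in [:: 0; e; 2 * e - 1; 2 * e]) || (3 * e - 1 <= k)) \/
  exists2 y, (e < y) && (2 * (y - e) <= e - 1) &
    forall k, S k = (k \in [:: 0; e; y]) || (2 * e <= k).
Proof.
move=> re fE; have l2 : l = 2 by case: (r_of_b_pred fE) => -[]; lia.
have [w [q [[[ew we] w2 wc e4] cE pq qg hS]]] := bounds_l2 l2 re fE.
have pb := p_bounds.
have [q0|q1] : q = 0 \/ q = 1 by lia.
  rewrite q0 in cE pq wc hS; have [p1|p2] : p = 1 \/ p = 2 by have := p_gt0; lia.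
    right; exists w; first by rewrite p1 in cE; lia.
    by move=> k; rewrite hS /multiples /run p1 /= !inE; rewrite p1 in cE; lia.
  left => k; rewrite hS /multiples /run p2 /= !inE; rewrite p2 in cE pb; lia.
exfalso; rewrite q1 in cE wc pq.
have [p3|p4] : p = 3 \/ p = 4 by move: cE pb; set P := p * e; lia.
  by rewrite p3 in cE pb; lia.
by rewrite p4 in cE pb; lia.
Qed.

Lemma shapes_b_type_l2 : r + 2 = e -> l = 2 -> f = c + r ->
  [\/ forall k, S k = (k \in [:: 0; 4; 8; 9; 12; 13]) || (16 <= k),
      forall k, S k = (k \in [:: 0; 4; 8; 11; 12; 15; 16]) || (19 <= k),
      4 <= e /\
        forall k, S k = (k \in [:: 0; e; 2 * e - 2; 2 * e]) || (3 * e - 2 <= k) |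
      4 <= e /\ exists2 z, (0 < z) && (2 * z <= e - 2) &
        forall k, S k = (k \in [:: 0; e; e + z]) || (2 * e - 1 <= k)].
Proof.
move=> re l2; rewrite -[X in X = _]addn0 => fE.
have [w [q [[[ew we] w2 wc e4] cE pq qg hS]]] := bounds_l2 l2 re fE.
have pb := p_bounds.
have [q0|[q1|q2]] : q = 0 \/ q = 1 \/ q = 2 by lia.
- rewrite q0 in cE pq wc hS; have [p1|p2] : p = 1 \/ p = 2 by have := p_gt0; lia.
    constructor 4; split=> //; exists (w - e); first by rewrite p1 in cE; lia.
    by move=> k; rewrite hS /multiples /run p1 /= !inE; rewrite p1 in cE; lia.
  constructor 3; split=> // k; rewrite hS /multiples /run p2 /= !inE.
  by rewrite p2 in cE pb; lia.
- rewrite q1 in cE wc pq hS.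
  have [p3|p4] : p = 3 \/ p = 4 by move: cE pb; set P := p * e; lia.
    rewrite p3 in cE pb; have [e4' w9] : e = 4 /\ w = 9 by lia.
    constructor 1 => k; rewrite hS /multiples /run p3 e4' w9 /= !inE.
    by rewrite e4' in cE; lia.
  rewrite p4 in cE pb; have [e4' w11] : e = 4 /\ w = 11 by lia.
  constructor 2 => k; rewrite hS /multiples /run p4 e4' w11 /= !inE.
  by rewrite e4' in cE; lia.
- exfalso; rewrite q2 in cE wc pq; have p6 : p = 6 by move: cE pb; set P := p * e; lia.
  by rewrite p6 in cE pb; lia.
Qed.

Lemma shapes_b_type_l3 : r = 2 -> e = 5 -> l = 3 -> f = c + r ->
  [\/ forall k, S k = (k \in [:: 0; 5; 6; 7]) || (10 <= k),
      forall k, S k = (k \in [:: 0; 5; 6; 8]) || (10 <= k) |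
      forall k, S k = (k \in [:: 0; 5; 8; 9; 10]) || (13 <= k)].
Proof.
move=> r2 e5 l3 fE.
have [w [q [w' [q' [[ew Sw nSw wc] [ew' Sw' nSw' wc'] [ww w0 w0' wn] nE' hS]]]]] := shape3 l3.
have rl : r + l = e by rewrite r2 l3 e5.
have wb : e < w < c by rewrite ew; case/andP: wc => /(leq_ltn_trans (leq_addr _ _)).
have wb' : e < w' < c by rewrite ew'; case/andP: wc' => /(leq_ltn_trans (leq_addr _ _)).
have sm := small3 rl wb wb' Sw Sw' nSw' ww hS.
have /andP[pb1 pb2] := p_bounds; have p1 := p_gt0.
rewrite nE' r2 in fE; rewrite e5 in pb1 pb2 sm wc wc' ew ew' w0 w0' wn.
have w10 : w != 10 by apply: contraNneq w0 => ->.
have w10' : w' != 10 by apply: contraNneq w0' => ->.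
have w5 : w' != w + 5 by apply: contraNneq wn => ->; rewrite modnDr.
clear w0 w0' wn.
have [[pE [wE wE']]|[[pE [wE wE']]|[pE [wE wE']]]] :
  (p = 1 /\ w = 6 /\ w' = 7) \/ (p = 1 /\ w = 6 /\ w' = 8) \/ (p = 2 /\ w = 8 /\ w' = 9).
  have qq : q + q' <= 1 by lia.
  have pp : p <= 3 by lia.
  have qq' : (q = 0 /\ q' = 0) \/ (q = 1 /\ q' = 0) \/ (q = 0 /\ q' = 1) by lia.
  clear Sw nSw Sw' nSw' hS rl wb wb' nE'.
  have pE : p = 1 \/ p = 2 \/ p = 3 by lia.
  by case: pE => [pE|[pE|pE]]; rewrite pE in pb1 pb2 fE;
    case: qq' => [[q0 q0']|[[q0 q0']|[q0 q0']]]; rewrite q0 q0' in wc wc' fE; lia.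
- constructor 1 => k; rewrite hS /multiples /run pE wE wE' e5; rewrite pE wE wE' in wc wc' fE.
  have [-> ->] : q = 0 /\ q' = 0 by lia.
  by rewrite /= !inE; lia.
- constructor 2 => k; rewrite hS /multiples /run pE wE wE' e5; rewrite pE wE wE' in wc wc' fE.
  have [-> ->] : q = 0 /\ q' = 0 by lia.
  by rewrite /= !inE; lia.
- constructor 3 => k; rewrite hS /multiples /run pE wE wE' e5; rewrite pE wE wE' in wc wc' fE.
  have [-> ->] : q = 0 /\ q' = 0 by lia.
  by rewrite /= !inE; lia.
Qed.

Lemma r_of_l2 : l = 2 -> r <= e - 2 -> r + 2 = e.
Proof. by move=> l2; have := type_ge; have := mult_gt0; have := r_gt1; lia. Qed.

(** The residue class of 2 e - 1 contributes nothing to R : m: an element e - 1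
    of T would put 3 e - 2 into S. *)
Lemma invariants_4_values :
  (forall k, S k = (k \in [:: 0; e; 2 * e - 1; 2 * e]) || (3 * e - 1 <= k)) ->
  [/\ n = 4, r + 2 = e & f + 1 = c + r].
Proof.
move=> h; have e3 : 3 <= e by have := type_le; have := r_gt1; lia.
have cE : c = 3 * e - 1.
  by apply: (c_eq_of_list h); rewrite ?inE; lia.
have uL : uniq [:: 0; e; 2 * e - 1; 2 * e] by rewrite /= !inE; lia.
have hL : all (fun k => k < 3 * e - 1) [:: 0; e; 2 * e - 1; 2 * e] by rewrite /=; lia.
have n4 : n = 4 by rewrite nE cE -[X in iota 0 X]subn0 (count_shape h).
have l2 : l = 2.
  rewrite l_window; have {2}-> : e = c - (c - e) by lia.
  rewrite {2}cE (count_shape h) //=; lia.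
have re : r + 2 = e.
  apply: r_of_l2 => //; apply: (@type_le_avoid e.-1); first by lia.
  move=> z zc Tz nSz; apply/eqP => ze.
  have Sy : S (2 * e - 1) by rewrite h !inE eqxx !orbT.
  have := divn_eq z e; rewrite ze; case: (z %/ e) => [|[|i]] zE.
  - have := T_S Tz Sy; rewrite h !inE; lia.
  - by case/negP: nSz; rewrite h !inE; apply/orP; left; apply/or4P; constructor 3; lia.
  - by move: zE; rewrite !mulSn; lia.
by split=> //; rewrite n4; lia.
Qed.

(** The residue class of y contributes nothing to R : m: an element y - e of T
    would put 2 y - e into S, and this lies strictly between e and 2 e and
    differs from y. *)
Lemma invariants_3_values y : e < y -> 2 * (y - e) <= e - 1 ->
  (forall k, S k = (k \in [:: 0; e; y]) || (2 * e <= k)) ->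
  [/\ n = 3, r + 2 = e & f + 1 = c + r].
Proof.
move=> ey ye h; have e3 : 3 <= e by have := type_le; have := r_gt1; lia.
have cE : c = 2 * e by apply: (c_eq_of_list h); rewrite ?inE; lia.
have uL : uniq [:: 0; e; y] by rewrite /= !inE; lia.
have hL : all (fun k => k < 2 * e) [:: 0; e; y] by rewrite /=; lia.
have n3 : n = 3 by rewrite nE cE -[X in iota 0 X]subn0 (count_shape h).
have l2 : l = 2.
  rewrite l_window; have {2}-> : e = c - (c - e) by lia.
  rewrite {2}cE (count_shape h) //=; lia.
have re : r + 2 = e.
  apply: r_of_l2 => //; apply: (@type_le_avoid (y - e)); first by lia.
  move=> z zc Tz nSz; apply/eqP => ze.
  have Sy : S y by rewrite h !inE eqxx !orbT.
  have := divn_eq z e; rewrite ze; case: (z %/ e) => [|[|i]] zE.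
  - have := T_S Tz Sy; rewrite h !inE; lia.
  - by case/negP: nSz; rewrite h !inE; apply/orP; left; apply/or3P; constructor 3; lia.
  - by move: zE; rewrite !mulSn; lia.
by split=> //; rewrite n3; lia.
Qed.

End Combinatorics.

End NumericalSemigroup.

(** * Values and the fractional ideals of the valuation ring *)

Section Values.
Variable R : idomainType.
Local Notation K := {fraction R}.
Variable v : K -> \bar int.
Hypothesis v_val : discrete_valuation v.
Implicit Types (N M P : set K) (k l : int).

(** For k >= 0 this is the k-th power of the maximal ideal of the valuation
    ring. *)
Definition vge k : set K := [set y | (k%:E <= v y)%E].

Definition vin M k : Prop := exists2 y, M y & v y = k%:E.

Lemma v_ninfty y : v y != -oo%E. Proof. by case: v_val. Qed.
Lemma v_infty y : v y = +oo%E <-> y = 0.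
Proof. by have [_ h _ _ _] := v_val; exact: h. Qed.
Lemma vM y z : v (y * z) = (v y + v z)%E. Proof. by case: v_val. Qed.

Lemma v_fin y : y != 0 -> exists k, v y = k%:E.
Proof.
move=> y0; case E: (v y) => [k||]; first by exists k.
- by move/v_infty/eqP: E; rewrite (negPf y0).
- by have := v_ninfty y; rewrite E.
Qed.

Lemma v_neq0 y k : v y = k%:E -> y != 0.
Proof. by move=> vy; apply/eqP => /v_infty; rewrite vy. Qed.

Lemma vge0 k : vge k 0.
Proof. by rewrite /vge /= (v_infty 0).2 // leey. Qed.

Lemma vgeD k y z : vge k y -> vge k z -> vge k (y + z).
Proof.
move=> hy hz; have [_ _ _ /(_ y z) h _] := v_val.
by apply: le_trans h; rewrite le_min; apply/andP.
Qed.

Lemma vgeM k l y z : vge k y -> vge l z -> vge (k + l) (y * z).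
Proof. by move=> hy hz; rewrite /vge /= vM EFinD; exact: leeD. Qed.

Lemma vgeW k l y : k <= l -> vge l y -> vge k y.
Proof. by move=> kl; apply: le_trans; rewrite lee_fin. Qed.

Lemma vge_of_eq k y : v y = k%:E -> vge k y.
Proof. by rewrite /vge /= => ->. Qed.

Lemma vgeE k l y : v y = k%:E -> vge l y <-> l <= k.
Proof. by rewrite /vge /= => ->; rewrite lee_fin. Qed.

Lemma v_eq k y : vge k y -> ~ vge (k + 1) y -> v y = k%:E.
Proof.
rewrite /vge /=; case: (v y) => [l||] //; rewrite ?leey //.
by rewrite !lee_fin => h1 h2; congr (_%:E); lia.
Qed.

Lemma vge_fin k y : y != 0 -> vge k y -> exists2 l, v y = l%:E & k <= l.
Proof.
by move=> /v_fin[l vy]; rewrite /vge /= vy lee_fin => kl; exists l.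
Qed.

Lemma vMk y z k l : v y = k%:E -> v z = l%:E -> v (y * z) = (k + l)%:E.
Proof. by rewrite vM => -> ->. Qed.

Lemma v1 : v 1 = 0%:E.
Proof.
have [k h] := v_fin (oner_neq0 K); have := vMk h h.
by rewrite mulr1 h => -[] ?; congr (_%:E); lia.
Qed.

Lemma vN1 : v (-1) = 0%:E.
Proof.
have n0 : (-1 : K) != 0 by rewrite oppr_eq0 oner_eq0.
have [k h] := v_fin n0.
by have := vMk h h; rewrite mulrNN mulr1 v1 h => -[] ?; congr (_%:E); lia.
Qed.

Lemma vN y : v (- y) = v y.
Proof. by rewrite -mulN1r vM vN1 add0e. Qed.

Lemma vgeN k y : vge k y -> vge k (- y).
Proof. by rewrite /vge /= vN. Qed.

Lemma vgeB k y z : vge k y -> vge k z -> vge k (y - z).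
Proof. by move=> hy hz; apply: vgeD => //; exact: vgeN. Qed.

Lemma vV y k : v y = k%:E -> v y^-1 = (- k)%:E.
Proof.
move=> vy; have y0 := v_neq0 vy.
have [|l vl] := @v_fin y^-1; first by rewrite invr_eq0.
by have := vMk vy vl; rewrite mulfV // v1 vl => -[] ?; congr (_%:E); lia.
Qed.

Lemma v_exists k : exists y, v y = k%:E.
Proof.
have [_ _ _ _ [u u1]] := v_val.
have hn (n : nat) : v (u ^+ n) = (n%:Z)%:E.
  elim: n => [|n IH]; first by rewrite expr0 v1.
  by rewrite exprS (vMk u1 IH); congr (_%:E); lia.
case: (intP k) => [|n|n]; first by exists 1; exact: v1.
- by exists (u ^+ n.+1).
- by exists (u ^+ n.+1)^-1; exact: vV.
Qed.

(** The term of strictly smaller value determines the value of a sum. *)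
Lemma v_dom y z k : v y = k%:E -> vge (k + 1) z -> v (y + z) = k%:E.
Proof.
move=> vy hz; apply: v_eq.
  by apply: vgeD; [exact: vge_of_eq|apply: vgeW hz; lia].
move=> h; have := vgeB h hz; rewrite addrK => /(vgeE _ vy); lia.
Qed.

Lemma vge_all y (k : int) : exists d : nat, vge (k - d%:Z) y.
Proof.
have [->|/v_fin[l vy]] := eqVneq y 0; first by exists 0%N; exact: vge0.
by exists `|k - l|%N; apply/(vgeE _ vy); lia.
Qed.

Lemma vin_ge M k l : M `<=` vge k -> vin M l -> k <= l.
Proof. by move=> Mk [y /Mk h vy]; apply/(vgeE _ vy). Qed.

Lemma vge_vin M k l : vge k `<=` M -> k <= l -> vin M l.
Proof.
move=> kM kl; have [y vy] := v_exists l; exists y => //; apply: kM.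
exact/(vgeE _ vy).
Qed.

Lemma vin_le M N k : M `<=` N -> vin M k -> vin N k.
Proof. by move=> MN [y /MN Ny vy]; exists y. Qed.

Hypothesis R_ge0 : forall a : R, vge 0 a%:F.

Lemma vge_submodule k : submodule (vge k).
Proof.
apply: submoduleI => [|y z|a y hy]; [exact: vge0|exact: vgeD|].
by rewrite -[k]add0r; exact: vgeM.
Qed.

Hypothesis residual : forall y, vge 0 y -> exists a : R, vge 1 (y - a%:F).

(** The residue field of R is that of the valuation ring, so leading terms can
    be cancelled with coefficients from R. *)
Lemma cancel_lead y z k : v y = k%:E -> v z = k%:E ->
  exists u : R, vge (k + 1) (y - u%:F * z).
Proof.
move=> vy vz; have [|u hu] := residual (y := y / z).
  by apply: vge_of_eq; rewrite (vMk vy (vV vz)) subrr.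
exists u; have := vgeM hu (vge_of_eq vz).
by rewrite mulrBl divfK ?(v_neq0 vz) // addrC.
Qed.

(** Among the elements of M outside N choose b of the largest value. If N had an
    element of that value, cancelling the leading term of b would give an
    element of M of larger value, hence in N, and b would be in N. *)
Lemma top_step N M k : submodule N -> submodule M -> vge k `<=` N ->
  N `<=` M -> N <> M -> exists b l,
  [/\ M b, ~ N b, v b = l%:E, ~ vin N l & forall y, M y -> vge (l + 1) y -> N y].
Proof.
move=> sN sM kN NM NneM.
pose Q d := `[< exists y, [/\ M y, ~ N y & vge (k - d%:Z) y] >].
have exQ : exists d, Q d.
  have [y [My nNy]] : exists y, M y /\ ~ N y.
    apply/not_existsP => h; apply: NneM; apply/seteqP; split=> // y My.
    by apply: contrapT => nNy; exact: (h y).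
  by have [d hd] := vge_all y k; exists d; apply/asboolP; exists y.
case: (ex_minnP exQ) => d /asboolP[b [Mb nNb hb]] dmin.
have up y : M y -> vge (k - d%:Z + 1) y -> N y.
  move=> My hy; apply: contrapT => nNy; case: d dmin hb hy => [|d] dmin hb hy.
    by apply/nNy/kN/vgeW/hy; lia.
  have : Q d by apply/asboolP; exists y; split=> //; apply: vgeW hy; lia.
  by move/dmin; rewrite ltnn.
have vb : v b = (k - d%:Z)%:E by apply: v_eq => // h; exact: nNb (up _ Mb h).
exists b, (k - d%:Z); split=> // -[z Nz vz].
have [u hu] := cancel_lead vb vz.
apply: nNb; rewrite -(subrK (u%:F * z) b); have Nuz : N (u%:F * z) by exact: submodM.
by apply: submodD => //; apply: up => //; apply: submodB => //; exact: NM.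
Qed.

(** An element of N + R b of value above l lies in N, and below l its value is
    that of its component in N. *)
Lemma vin_addline N M b l k : submodule N -> submodule M -> N `<=` M -> M b ->
  v b = l%:E -> (forall y, M y -> vge (l + 1) y -> N y) ->
  vin (addm N (line b)) k <-> vin N k \/ k = l.
Proof.
move=> sN sM NM Mb vb up.
have sub := addm_le sM NM (line_le sM Mb).
split=> [[y /[dup] /sub My [z Nz [w [a _ <-] zy]] vy]|[|->]]; last first.
- by exists b => //; apply: addm_r => //; exact: line_mem.
- by apply: vin_le; apply: addm_l; exact: line_sub.
have [->|kl] := eqVneq k l; [by right|left].
have [lk|lk] := leP (l + 1) k; first by exists y => //; apply: up => //; exact/(vgeE _ vy).
exists z => //; have -> : z = y + - (a%:F * b) by rewrite -zy addrK.
apply: v_dom => //; apply: vgeN; apply: (@vgeW _ (0 + l)); first by lia.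
by apply: vgeM => //; exact: vge_of_eq.
Qed.

(** * Lengths count values *)

Definition cnt (lo : int) (w : nat) M : nat :=
  count (fun i : nat => `[< vin M (lo + i%:Z) >]) (iota 0 w).

(** Modules for which the count in the window from lo to lo + w sees everything
    that varies. *)
Definition window lo (w : nat) M : Prop :=
  [/\ submodule M, vge (lo + w%:Z) `<=` M & M `<=` vge lo].

Lemma cnt_le lo w N M : N `<=` M -> (cnt lo w N <= cnt lo w M)%N.
Proof.
by move=> NM; apply: sub_count => i /asboolP h; apply/asboolP/vin_le/h.
Qed.

Lemma cnt_add1 lo w N N' l : ~ vin N l -> lo <= l < lo + w%:Z ->
  (forall k, vin N' k <-> vin N k \/ k = l) -> cnt lo w N' = (cnt lo w N).+1.
Proof.
move=> nl /andP[l1 l2] h.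
have := count_predUI (fun i : nat => `[< vin N (lo + i%:Z) >])
  (pred1 `|l - lo|%N) (iota 0 w).
rewrite [count (predI _ _) _](@eq_count _ _ pred0); last first.
  move=> i /=; apply/negbTE/negP => /andP[/asboolP hi /eqP ii]; apply: nl.
  by move: hi; have -> : lo + i%:Z = l by lia.
rewrite count_pred0 addn0 [count (pred1 _) _]count_uniq_mem ?iota_uniq //.
rewrite mem_iota /= add0n; have -> : (`|l - lo| < w)%N by lia.
rewrite addn1 => <-; apply: eq_count => i /=.
apply/asboolP/orP => [/h[hi|hi]|[/asboolP hi|/eqP hi]].
- by left; apply/asboolP.
- by right; apply/eqP; lia.
- by apply/h; left.
- by apply/h; right; lia.
Qed.

(** Every proper inclusion N < M can be started with a simple step: m b is
    contained in N, because multiplication by an element of m raises the value. *)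
Lemma grow_step lo w N M : window lo w N -> window lo w M -> N `<` M ->
  exists b l, let N' := addm N (line b) in
  [/\ window lo w N', N `<` N', N' `<=` M, cnt lo w N' = (cnt lo w N).+1 &
   [/\ v b = l%:E, ~ N b & forall y, M y -> vge (l + 1) y -> N y]].
Proof.
move=> [sN hN Nlo] [sM hM Mlo] [NM MnN].
have [|b [l [Mb nNb vb nvl up]]] := top_step sN sM hN NM.
  by move=> h; apply: MnN; rewrite h.
have sub := addm_le sM NM (line_le sM Mb).
have lN := @addm_l _ N _ (line_sub b).
exists b, l; split=> //.
- split; first by apply: addm_sub => //; exact: line_sub.
  + by move=> y /hN /lN.
  + by move=> y /sub /Mlo.
- split=> // /(_ b) h; apply: nNb; apply: h.
  by apply: addm_r => //; exact: line_mem.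
- apply: (cnt_add1 nvl) => [|k]; last exact: vin_addline vb up.
  apply/andP; split; first by apply/(vgeE _ vb); exact: Mlo.
  by rewrite ltNge; apply/negP => h; apply/nNb/hN/(vgeE _ vb).
Qed.

Lemma cnt_lt lo w N M : window lo w N -> window lo w M -> N `<` M ->
  (cnt lo w N < cnt lo w M)%N.
Proof.
move=> wN wM NM; have [b [l [_ _ sub <- _]]] := grow_step wN wM NM.
exact: cnt_le.
Qed.

Lemma window_mid lo w N M P : submodule P -> N `<=` P -> P `<=` M ->
  window lo w N -> window lo w M -> window lo w P.
Proof.
move=> sP NP PM [_ hN _] [_ _ hM]; split=> //.
- by move=> y /hN /NP.
- by move=> y /PM /hM.
Qed.

Lemma chain_le n (C : nat -> set K) :
  (forall i, (i < n)%N -> C i `<` C i.+1) ->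
  forall i j, (i <= j <= n)%N -> C i `<=` C j.
Proof.
move=> h i j /andP[]; elim: j => [|j IH]; first by rewrite leqn0 => /eqP -> _ y.
rewrite leq_eqVlt => /orP[/eqP -> _ y //|ij jn].
by apply: subset_trans (h j jn).1; apply: IH => //; exact: ltnW.
Qed.

Lemma chain_cnt lo w N M n : window lo w N -> window lo w M ->
  submodule_chain N M n -> (n + cnt lo w N <= cnt lo w M)%N.
Proof.
move=> wN wM [C [C0 Cn sC ltC]].
have wC i : (i <= n)%N -> window lo w (C i).
  move=> i_n; apply: window_mid wN wM; first exact: sC.
  - by rewrite -C0; apply: (chain_le ltC).
  - by rewrite -Cn; apply: (chain_le ltC); rewrite i_n leqnn.
suff h i : (i <= n)%N -> (i + cnt lo w N <= cnt lo w (C i))%N.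
  by rewrite -Cn; exact: h.
elim: i => [|i IH] i_n; first by rewrite C0.
rewrite addSn; apply: leq_ltn_trans (IH (ltnW i_n)) _.
by apply: cnt_lt (ltC i i_n); apply: wC => //; exact: ltnW.
Qed.

Lemma chain_exists lo w N M d : window lo w N -> window lo w M -> N `<=` M ->
  (d + cnt lo w N)%N = cnt lo w M -> submodule_chain N M d.
Proof.
elim: d N => [|d IH] N wN wM NM h.
  have -> : N = M.
    apply: contrapT => ne; have NltM : N `<` M.
      by split=> // MN; apply: ne; exact/seteqP.
    by have := cnt_lt wN wM NltM; lia.
  by exists (fun=> M); split=> // i _; case: wM.
have NltM : N `<` M by split=> // MN; have := cnt_le lo w MN; lia.
have [b [l [wN' NN' N'M cN' _]]] := grow_step wN wM NltM.
have [|C [C0 Cd sC ltC]] := IH _ wN' wM N'M; first by rewrite cN'; lia.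
exists (fun i => if i is i'.+1 then C i' else N); split=> //.
- by case=> [|i] hi; [case: wN|exact: sC].
- by case=> [|i] hi; [rewrite C0|exact: ltC].
Qed.

(** Value counts increase strictly along a chain of submodules, and adjoining
    one value at a time gives a chain that uses them all. *)
Lemma len_cnt lo w N M : window lo w N -> window lo w M -> N `<=` M ->
  (len M N + cnt lo w N)%N = cnt lo w M.
Proof.
move=> wN wM NM; have le := cnt_le lo w NM.
pose d := (cnt lo w M - cnt lo w N)%N.
have hd : submodule_chain N M d.
  by apply: (chain_exists wN wM NM); rewrite subnK.
suff -> : len M N = d by rewrite subnK.
rewrite /len; apply: xget_unique => [|l [hl lmax]].
  by split=> // n /(chain_cnt wN wM); rewrite /d; lia.
by have := lmax _ hd; have := chain_cnt wN wM hl; rewrite /d; lia.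
Qed.

(** The fractional ideals, bounded on both sides by powers of t. *)
Definition fractional M : Prop := exists lo w, window lo w M.

Lemma frac_window M (k k' : int) : submodule M -> vge k `<=` M -> M `<=` vge k' ->
  k' <= k -> window k' `|k - k'|%N M.
Proof. by move=> sM kM Mk kk; split=> //; have -> : k' + `|k - k'|%N = k by lia. Qed.

Lemma fractionalP M : fractional M <->
  submodule M /\ (exists k, vge k `<=` M) /\ (exists k, M `<=` vge k).
Proof.
split=> [[lo [w [sM h1 h2]]]|[sM [[k h1] [k' h2]]]].
  by split=> //; split; [exists (lo + w%:Z)|exists lo].
have [kk|kk] := leP k' k; first by exists k', `|k - k'|%N; exact: frac_window.
exists k, 0%N; split=> //; first by rewrite addr0.
by move=> y /h2; apply: vgeW; exact: ltW.
Qed.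

Lemma common_window N M : fractional N -> fractional M -> N `<=` M ->
  exists lo w, window lo w N /\ window lo w M.
Proof.
move=> /fractionalP[sN [[k hk] _]] /fractionalP[sM [_ [k' hk']]] NM.
have [kk|kk] := leP k' k.
  by exists k', `|k - k'|%N; split; apply: frac_window => // y;
    [move=> /NM /hk'|move=> /hk /NM].
exists k, 0%N; have h : M `<=` vge k by move=> y /hk'; apply: vgeW; exact: ltW.
by split; split; rewrite ?addr0 // => y; [move/NM/h|move/hk/NM].
Qed.

Lemma fractional_mid N M P : submodule P -> N `<=` P -> P `<=` M ->
  fractional N -> fractional M -> fractional P.
Proof.
move=> sP NP PM /fractionalP[_ [[k hk] _]] /fractionalP[_ [_ [k' hk']]].
apply/fractionalP; split=> //; split; [exists k|exists k'] => y; first by move/hk/NP.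
by move/PM/hk'.
Qed.

Lemma lenD N P M : fractional N -> fractional M -> submodule P -> N `<=` P -> P `<=` M ->
  len M N = (len M P + len P N)%N.
Proof.
move=> fN fM sP NP PM.
have [lo [w [wN wM]]] := common_window fN fM (subset_trans NP PM).
have wP := window_mid sP NP PM wN wM.
have := len_cnt wN wM (subset_trans NP PM).
by have := len_cnt wN wP NP; have := len_cnt wP wM PM; lia.
Qed.

Lemma len_gt0 N M : fractional N -> fractional M -> N `<` M -> (0 < len M N)%N.
Proof.
move=> fN fM NM; have [lo [w [wN wM]]] := common_window fN fM NM.1.
by have := cnt_lt wN wM NM; rewrite -(len_cnt wN wM NM.1); lia.
Qed.

Lemma len_chain N M : fractional N -> fractional M -> N `<=` M ->
  submodule_chain N M (len M N).
Proof.
move=> fN fM NM; have [lo [w [wN wM]]] := common_window fN fM NM.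
by apply: (chain_exists wN wM NM); exact: len_cnt wN wM NM.
Qed.

Lemma chain_len N M n : fractional N -> fractional M -> N `<=` M ->
  submodule_chain N M n -> (n <= len M N)%N.
Proof.
move=> fN fM NM /chain_cnt h; have [lo [w [wN wM]]] := common_window fN fM NM.
by have := h lo w wN wM; rewrite -(len_cnt wN wM NM); lia.
Qed.

Lemma lenxx N : fractional N -> len N N = 0%N.
Proof.
move=> fN; have NN := @subset_refl _ N.
by have := lenD fN fN ((fractionalP N).1 fN).1 NN NN; lia.
Qed.

(** The form of the one-value step that does not mention windows. *)
Lemma len_grow N M : fractional N -> fractional M -> N `<` M -> exists b,
  let N' := addm N (line b) in
  [/\ fractional N', N `<` N', N' `<=` M, len N' N = 1%N &
      ~ N b /\ forall a : R, vge 1 a%:F -> N (a%:F * b)].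
Proof.
move=> fN fM NM; have [lo [w [wN wM]]] := common_window fN fM NM.1.
have [b [l [wN' NN' N'M cN' [vb nNb up]]]] := grow_step wN wM NM.
have Mb : M b by apply: N'M; apply: addm_r; [case: wN|exact: line_mem].
exists b; split=> //; first by exists lo, w.
  by have := len_cnt wN wN' NN'.1; rewrite cN'; lia.
split=> // a ha; apply: up; first by apply: submodM => //; case: wM.
by rewrite addrC; apply: vgeM => //; exact: vge_of_eq.
Qed.

Lemma fractional_scale b N : b != 0 -> fractional N -> fractional (scalem b N).
Proof.
move=> b0 /fractionalP[sN [[k hk] [k' hk']]]; have [l vb] := v_fin b0.
apply/fractionalP; split; first exact: scalem_sub.
split; [exists (l + k)|exists (l + k')].
  move=> y hy; have := vgeM (vge_of_eq (vV vb)) hy; rewrite addKr => /hk h.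
  by exists (b^-1 * y) => //; rewrite mulVKf.
by move=> _ [y /hk' hy <-]; apply: vgeM => //; exact: vge_of_eq.
Qed.

Lemma chain_scale b N M n : b != 0 -> submodule_chain N M n ->
  submodule_chain (scalem b N) (scalem b M) n.
Proof.
move=> b0 [C [<- <- sC ltC]]; exists (fun i => scalem b (C i)); split=> //.
  by move=> i hi; apply/scalem_sub/sC.
move=> i hi; have [h1 h2] := ltC i hi; split; first exact: scalem_le.
move=> h; apply: h2 => y Cy; apply/(scalemP _ _ b0)/h; exact/scalemP.
Qed.

Lemma len_scale b N M : b != 0 -> fractional N -> fractional M -> N `<=` M ->
  len (scalem b M) (scalem b N) = len M N.
Proof.
move=> b0 fN fM NM; apply/eqP; rewrite eqn_leq; apply/andP; split; last first.
  apply: chain_len; try exact: fractional_scale; first exact: scalem_le.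
  by apply: chain_scale => //; exact: len_chain.
have bK P : scalem b^-1 (scalem b P) = P.
  apply/seteqP; split=> [_ [_ [y Py <-] <-]|y Py]; first by rewrite mulKf.
  by exists (b * y); [exists y|rewrite mulKf].
apply: chain_len => //.
rewrite -[X in submodule_chain X](bK N) -[X in submodule_chain _ X](bK M).
apply: chain_scale; rewrite ?invr_eq0 //.
by apply: len_chain; try exact: fractional_scale; exact: scalem_le.
Qed.

(** The hypotheses say that M1 / M0 embeds into Q / P: by the modular law, a
    strict chain from M0 to M1 stays strict after adding P. *)
Lemma len_diamond M0 M1 P Q : fractional M0 -> fractional M1 -> fractional P -> fractional Q ->
  M0 `<=` M1 -> P `<=` Q -> M1 `<=` Q -> M1 `&` P `<=` M0 ->
  (len M1 M0 <= len Q P)%N.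
Proof.
move=> f0 f1 fP fQ M01 PQ MQ MP.
have [C [C0 Cn sC ltC]] := len_chain f0 f1 M01; set n := len M1 M0 in Cn sC ltC *.
have sP := ((fractionalP P).1 fP).1; have sQ := ((fractionalP Q).1 fQ).1.
have leC := chain_le ltC.
have CM i : (i <= n)%N -> C i `<=` M1 by rewrite -Cn => hi; apply: leC; rewrite hi leqnn.
have MC i : (i <= n)%N -> M0 `<=` C i by rewrite -C0 => hi; exact: leC.
pose D i := addm (C i) P.
have sD i : (i <= n)%N -> submodule (D i) by move=> hi; apply: addm_sub => //; exact: sC.
have PD i : (i <= n)%N -> P `<=` D i by move=> hi; apply: addm_r; exact: sC.
have DQ i : (i <= n)%N -> D i `<=` Q.
  by move=> hi; apply: addm_le => //; exact: subset_trans (CM i hi) MQ.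
have fD i : (i <= n)%N -> fractional (D i).
  by move=> hi; apply: (fractional_mid (sD _ hi) (PD _ hi) (DQ _ hi)).
have le0n : D 0%N `<=` D n.
  by move=> _ [y Cy [z Pz <-]]; exists y; [apply: (leC 0%N) => //; lia|exists z].
apply: (@leq_trans (len (D n) (D 0%N))); last first.
  have lD := lenD fP (fD n (leqnn n)) (sD 0%N isT) (PD 0%N isT) le0n.
  by rewrite (lenD fP fQ (sD n _) (PD n _) (DQ n _)) // lD; lia.
apply: (chain_len (fD _ _) (fD _ _)) => //; exists D; split=> // i hi; split.
  by move=> _ [y Cy [z Pz <-]]; exists y; [exact: (ltC i hi).1|exists z].
move=> h; apply: (ltC i hi).2 => y Cy.
have [|y' Cy' [z Pz yE]] := h y; first exact: addm_l.
rewrite -yE; apply: submodD => //; first exact/sC/ltnW.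
apply: (MC i (ltnW hi)); apply: MP; split=> //.
have -> : z = y - y' by rewrite -yE addrC addKr.
have sM := ((fractionalP M1).1 f1).1.
by apply: submodB => //; [exact: (CM i.+1)|exact: (CM i (ltnW hi))].
Qed.

(** * Colon modules and the type *)

Variables (c : nat) (m : set R).
Hypothesis c_sub : vge c%:Z `<=` ringK R.
Hypothesis c_min : forall k, vge k `<=` ringK R -> c%:Z <= k.
Hypothesis m_ge1 : forall a : R, m a <-> vge 1 a%:F.

Definition Rge (k : nat) : set K := ringK R `&` vge k%:Z.
Local Notation Rm := (colon (ringK R) (embed m)).

Lemma ringK_ge0 : ringK R `<=` vge 0.
Proof. by move=> _ [a _ <-]. Qed.

Lemma fractional_sub M : fractional M -> submodule M.
Proof. by case/fractionalP. Qed.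

Lemma ringK_fractional : fractional (ringK R).
Proof.
by apply/fractionalP; split; [exact: ringK_sub|split; [exists c|exists 0; exact: ringK_ge0]].
Qed.

Lemma Rge_fractional (k : nat) : fractional (Rge k).
Proof.
apply: (fractional_mid (N := vge (maxn c k)) (M := ringK R)).
- apply: submoduleI => [|y z [? ?] [? ?]|a y [? ?]].
  + by split; [exact: submod0 (ringK_sub R)|exact: vge0].
  + by split; [apply: submodD => //; exact: ringK_sub|exact: vgeD].
  + by split; apply: submodM => //; [exact: ringK_sub|exact: vge_submodule].
- by move=> y hy; split; [apply: c_sub|]; apply: vgeW hy; lia.
- by move=> y [].
- by apply/fractionalP; split; [exact: vge_submodule|split; eexists; exact: subset_refl].
- exact: ringK_fractional.
Qed.

Lemma vge_fractional k : fractional (vge k).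
Proof. by apply/fractionalP; split; [exact: vge_submodule|split; exists k]. Qed.

Lemma embed_m : embed m = Rge 1.
Proof.
apply/seteqP; split=> [_ [a ma <-]|_ [[a _ <-] ha]].
  by split; [exact: ringK_mem|exact/m_ge1].
by exists a => //; exact/m_ge1.
Qed.

Lemma colon_fractional J : fractional J -> fractional (colon (ringK R) J).
Proof.
case/fractionalP=> sJ [[k hk] [k' hk']]; apply/fractionalP; split.
  by apply: colon_sub; exact: ringK_sub.
split; [exists (c%:Z - k')|exists (- k)].
  move=> y hy z /hk' hz; apply: c_sub; have := vgeM hy hz.
  by rewrite subrK.
move=> y hy; have [z vz] := v_exists k; have z0 := v_neq0 vz.
have /hy/ringK_ge0 h : J z by apply: hk; exact: vge_of_eq.
have := vgeM h (vge_of_eq (vV vz)); rewrite mulfK //.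
by apply: vgeW; lia.
Qed.

Lemma Rm_fractional : fractional Rm.
Proof. by rewrite embed_m; apply: colon_fractional; exact: Rge_fractional. Qed.

Lemma ringK_Rm : ringK R `<=` Rm.
Proof.
by rewrite -{1}colon_ringK; apply: colon_le; rewrite embed_m => y [].
Qed.

(** Multiplication by b maps R : J into R : m, since m b is contained in J, and
    the elements that it maps into R are those of R : (J + R b). *)
Lemma colon_step J b : fractional J -> b != 0 ->
  (forall a : R, vge 1 a%:F -> J (a%:F * b)) -> fractional (addm J (line b)) ->
  (len (colon (ringK R) J) (colon (ringK R) (addm J (line b))) <= cm_type m)%N.
Proof.
move=> fJ b0 mb fJ'; set J' := addm J _.
have JJ' : J `<=` J' by apply: addm_l; exact: line_sub.
have le : colon (ringK R) J' `<=` colon (ringK R) J by exact: colon_le.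
have f1 := colon_fractional fJ; have f0 := colon_fractional fJ'.
rewrite -(len_scale b0 f0 f1 le).
apply: len_diamond; rewrite -/Rm.
- exact: fractional_scale.
- exact: fractional_scale.
- exact: ringK_fractional.
- exact: Rm_fractional.
- exact: scalem_le.
- exact: ringK_Rm.
- move=> _ [y hy <-]; rewrite embed_m => _ [[a _ <-] ha].
  rewrite (mulrC b) -mulrA (mulrC b); apply: hy; exact: mb.
- move=> _ [[y hy <-] hby]; exists y => // _ [z Jz [_ [a _ <-] <-]].
  rewrite mulrDr; apply: submodD; [exact: ringK_sub|exact: hy|].
  by rewrite mulrCA (mulrC y); apply: submodM => //; exact: ringK_sub.
Qed.

(** Each simple step of J / J' contributes at most the type. *)
Lemma len_colon_le J J' : fractional J -> fractional J' -> J' `<=` J ->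
  (len (colon (ringK R) J') (colon (ringK R) J) <= cm_type m * len J J')%N.
Proof.
move=> fJ; move Ed: (len J J') => d; elim: d J' Ed => [|d IH] J' Ed fJ' J'J.
  have -> : J' = J.
    apply: contrapT => ne; have : J' `<` J by split=> // JJ'; apply: ne; exact/seteqP.
    by move/(len_gt0 fJ' fJ); rewrite Ed.
  by rewrite lenxx //; exact: colon_fractional.
have J'ltJ : J' `<` J.
  split=> // JJ'; have JE : J' = J by exact/seteqP.
  by move: Ed; rewrite JE lenxx.
have [b [fN [J'N NJ' NJ l1 [nb mb]]]] := len_grow fJ' fJ J'ltJ.
set N := addm J' (line b) in fN J'N NJ' NJ l1.
have sN := fractional_sub fN.
have lJ := lenD fJ' fJ sN J'N NJ.
pose C := colon (ringK R).
have -> : len (colon (ringK R) J') (colon (ringK R) J) =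
    (len (C J') (C N) + len (C N) (C J))%N.
  apply: lenD; try exact: colon_fractional; try exact: colon_le.
  exact: colon_sub (ringK_sub R).
have b0 : b != 0.
  by apply/eqP => b0; apply: nb; rewrite b0; exact: submod0 (fractional_sub fJ').
have h1 := colon_step fJ' b0 mb fN.
have lN : len J N = d by lia.
by move: h1 (IH N lN fN NJ); rewrite -/N /C; lia.
Qed.

(** * The invariants in terms of the value semigroup *)

Lemma cnt0 w M : cnt 0 w M = count (fun i : nat => `[< vin M i%:Z >]) (iota 0 w).
Proof. by apply: eq_count => i /=; rewrite add0r. Qed.

Lemma window0 (w : nat) M : submodule M -> vge w%:Z `<=` M -> M `<=` vge 0 -> window 0 w M.
Proof. by move=> sM h1 h2; split=> //; rewrite add0r. Qed.

Lemma vin_ringK (k : nat) : vin (ringK R) k%:Z <-> value_set v k.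
Proof.
split=> [[_ [a _ <-] va]|[a [_ _ va]]]; last by exists a%:F => //; exists a.
by exists a; split=> //; have := v_neq0 va; rewrite tofrac_eq0.
Qed.

(** Boolean form of membership in the value semigroup, for use with [count]. *)
Definition Sb (k : nat) : bool := `[< value_set v k >].
Definition Tb (k : nat) : bool := `[< vin Rm k%:Z >].

Lemma cnt_ringK w : cnt 0 w (ringK R) = count Sb (iota 0 w).
Proof. by rewrite cnt0; apply: eq_count => i; apply/asbool_equiv_eq/vin_ringK. Qed.

Lemma ringK_window : window 0 c (ringK R).
Proof. by apply: window0; [exact: ringK_sub|exact: c_sub|exact: ringK_ge0]. Qed.

Lemma vge_window (k w : nat) : (k <= w)%N -> window 0 w (vge k%:Z).
Proof.
by move=> kw; apply: window0 => [|y|y]; [exact: vge_submodule| |]; apply: vgeW; lia.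
Qed.

Lemma Rge_window (k : nat) : (k <= c)%N -> window 0 c (Rge k).
Proof.
move=> kc; apply: window0 => [|y hy|y [/ringK_ge0//]].
  exact/fractional_sub/Rge_fractional.
by split; [exact: c_sub|apply: vgeW hy; lia].
Qed.

Hypothesis Rbar : int_closure R = vge 0.

(** An element y of the conductor carries the whole power of t of exponent v(y)
    into R. *)
Lemma conductorE : conductor R = vge c%:Z.
Proof.
apply/seteqP; split=> [y hy|y hy z]; last first.
  rewrite Rbar => hz; apply: c_sub; have := vgeM hy hz.
  by rewrite addr0.
have [->|/v_fin[k vy]] := eqVneq y 0; first exact: vge0.
apply/(vgeE _ vy); apply: c_min => z hz.
have y0 := v_neq0 vy; rewrite -(mulVKf y0 z); apply: hy; rewrite Rbar.
by have := vgeM (vge_of_eq (vV vy)) hz; rewrite addNr.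
Qed.

Lemma cnt_ge (k w : nat) : (k <= w)%N -> cnt 0 w (vge k%:Z) = (w - k)%N.
Proof.
move=> kw; rewrite cnt0; have {1}-> : w = (k + (w - k))%N by rewrite subnKC.
rewrite iotaD count_cat.
rewrite (@eq_in_count _ _ pred0 (iota 0 k)) ?count_pred0; last first.
  move=> i; rewrite mem_iota => hi; apply/asboolP => h.
  have := vin_ge (@subset_refl _ (vge k)) h; lia.
rewrite (@eq_in_count _ _ predT) ?count_predT ?size_iota // => i.
rewrite mem_iota => hi; apply/asboolP; apply: (vge_vin (@subset_refl _ (vge k))); lia.
Qed.

Lemma cond_lenE : cond_len R = c.
Proof.
rewrite /cond_len conductorE Rbar.
have := len_cnt (vge_window (leqnn c)) (vge_window (leq0n c)).
rewrite !cnt_ge // subnn addn0 subn0; apply => y; apply: vgeW; lia.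
Qed.

Definition nvalues : nat := count Sb (iota 0 c).

Lemma len_ringK_conductor : len (ringK R) (conductor R) = nvalues.
Proof.
rewrite conductorE; have := len_cnt (vge_window (leqnn c)) ringK_window c_sub.
by rewrite cnt_ge // subnn addn0 cnt_ringK.
Qed.

Lemma deltaE : (delta R + nvalues)%N = c.
Proof.
rewrite /delta Rbar.
have := len_cnt ringK_window (vge_window (leq0n c)) ringK_ge0.
by rewrite cnt_ringK cnt_ge ?subn0.
Qed.

(** An element y of R : J with v(y) < 0 would carry t^c Rbar onto a strictly
    larger ideal of Rbar contained in R. *)
Lemma colon_ge0 J : vge c%:Z `<=` J -> colon (ringK R) J `<=` vge 0.
Proof.
move=> cJ y hy; have [->|/v_fin[k vy]] := eqVneq y 0; first exact: vge0.
apply/(vgeE _ vy); have : c%:Z <= k + c%:Z; last by lia.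
apply: c_min => z hz; have y0 := v_neq0 vy; rewrite -(mulVKf y0 z); apply: hy.
apply: cJ; have := vgeM (vge_of_eq (vV vy)) hz.
by have -> : - k + (k + c%:Z) = c%:Z by lia.
Qed.

Lemma colon_window J : vge c%:Z `<=` J -> J `<=` ringK R ->
  window 0 c (colon (ringK R) J).
Proof.
move=> cJ JR; apply: window0; [exact: colon_sub (ringK_sub R)| |exact: colon_ge0].
by move=> y /c_sub; rewrite -{1}colon_ringK; apply: colon_le.
Qed.

Lemma vge_Rge (k : nat) : (k <= c)%N -> vge c%:Z `<=` Rge k.
Proof. by case/Rge_window => _; rewrite add0r. Qed.

Lemma Tb_S (k s : nat) : Tb k -> Sb s -> (0 < s)%N -> Sb (k + s).
Proof.
move=> /asboolP[y hy vy] /asboolP[a [_ a0 va]] s0; apply/asboolP/vin_ringK.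
exists (y * a%:F); last by rewrite (vMk vy va).
by apply: hy; exists a => //; apply/m_ge1/(vgeE _ va); lia.
Qed.

Lemma S_Tb (k : nat) : Sb k -> Tb k.
Proof. by move/asboolP/vin_ringK => h; apply/asboolP; apply: vin_le h; exact: ringK_Rm. Qed.

Lemma Sb_ge (k : nat) : (c <= k)%N -> Sb k.
Proof. by move=> ck; apply/asboolP/vin_ringK/(vge_vin c_sub); lia. Qed.

Hypothesis c_gt0 : (0 < c)%N.

Lemma typeE : (cm_type m + nvalues)%N = count Tb (iota 0 c).
Proof.
have h : window 0 c Rm by rewrite embed_m; apply: colon_window; [exact: vge_Rge|move=> y []].
by have := len_cnt ringK_window h ringK_Rm; rewrite cnt_ringK cnt0.
Qed.

(** If c - 1 were a value, cancelling leading terms would put all elements of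
    value c - 1 into R, against the minimality of c. *)
Lemma Sb_pred_c : ~~ Sb c.-1.
Proof.
apply/negP => /asboolP/vin_ringK[z Rz vz].
suff : c%:Z <= c.-1%:Z by lia.
apply: c_min => y hy; have [|nhy] := pselect (vge c y); first exact: c_sub.
have vy : v y = (c.-1%:Z)%:E by apply: v_eq => // h; apply: nhy; apply: vgeW h; lia.
have [u hu] := cancel_lead vy vz; rewrite -(subrK (u%:F * z) y).
apply: submodD; [exact: ringK_sub| |apply: submodM => //; exact: ringK_sub].
by apply: c_sub; apply: vgeW hu; lia.
Qed.

Lemma SbD (k l : nat) : Sb k -> Sb l -> Sb (k + l).
Proof.
move=> /asboolP/vin_ringK[y Ry vy] /asboolP/vin_ringK[z Rz vz].
apply/asboolP/vin_ringK; exists (y * z); first exact: ringK_mul.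
by rewrite (vMk vy vz).
Qed.

Lemma Sb0 : Sb 0.
Proof.
by apply/asboolP/vin_ringK; exists 1; rewrite ?v1 // -tofrac1; exact: ringK_mem.
Qed.

Lemma vin_Rge (k i : nat) : `[< vin (Rge k) i%:Z >] = (k <= i)%N && Sb i.
Proof.
apply/asboolP/andP => [[y [Ry hy] vy]|[ki /asboolP/vin_ringK[y Ry vy]]].
  split; first by move/(vgeE _ vy): hy; lia.
  by apply/asboolP/vin_ringK; exists y.
by exists y => //; split=> //; apply/(vgeE _ vy); lia.
Qed.

Lemma len_Rge (k k' : nat) : (k <= k' <= c)%N ->
  len (Rge k) (Rge k') = count Sb (iota k (k' - k)).
Proof.
move=> /andP[kk kc].
have le : Rge k' `<=` Rge k by move=> y [Ry hy]; split=> //; apply: vgeW hy; lia.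
have := len_cnt (Rge_window kc) (Rge_window (leq_trans kk kc)) le; rewrite !cnt0.
have h j : (j <= c)%N -> count (fun i : nat => `[< vin (Rge j) i%:Z >]) (iota 0 c) =
    count Sb (iota j (c - j)).
  move=> jc; have {1}-> : c = (j + (c - j))%N by rewrite subnKC.
  rewrite iotaD count_cat (@eq_in_count _ _ pred0 (iota 0 j)).
    rewrite count_pred0; apply: eq_in_count => i; rewrite mem_iota => /andP[ji _].
    by rewrite vin_Rge ji.
  by move=> i; rewrite mem_iota vin_Rge add0n /= => ij; rewrite leqNgt ij.
rewrite !h //; last by lia.
have -> : (c - k = (k' - k) + (c - k'))%N by lia.
by rewrite iotaD count_cat subnKC //; lia.
Qed.

Lemma Rge0 : Rge 0 = ringK R.
Proof. by apply/seteqP; split=> [y []|y Ry] //; split=> //; exact: ringK_ge0. Qed.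

Lemma colon_Rgec : colon (ringK R) (Rge c) = vge 0.
Proof.
apply/seteqP; split; first by apply: colon_ge0; exact: vge_Rge.
by move=> y hy z [_ hz]; apply: c_sub; have := vgeM hy hz; rewrite add0r.
Qed.

(** R : Rge k contains R and every element of value at least c - k, so that only
    the values 1, ..., j - 1 can be missing. *)
Lemma len_colon_tail (k j : nat) : (k <= c <= k + j)%N -> (0 < j)%N ->
  (len (vge 0) (colon (ringK R) (Rge k)) <= j.-1)%N.
Proof.
move=> /andP[kc ckj] j0.
have wk : window 0 c (colon (ringK R) (Rge k)).
  by apply: colon_window; [exact: vge_Rge|move=> y []].
have w0 : window 0 c (vge 0) := vge_window (leq0n c).
have [sN _ le] := wk; have := len_cnt wk w0 le; rewrite (cnt_ge (leq0n c)) subn0.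
suff : (c - j.-1 <= cnt 0 c (colon (ringK R) (Rge k)))%N by lia.
have hge i : (j <= i)%N -> vin (colon (ringK R) (Rge k)) i%:Z.
  move=> ji; have [y vy] := v_exists i; exists y => // z [_ hz]; apply: c_sub.
  by apply: vgeW (vgeM (vge_of_eq vy) hz); lia.
have h0 : vin (colon (ringK R) (Rge k)) 0%:Z.
  exists 1; last exact: v1.
  by move=> z [Rz _]; rewrite mul1r.
rewrite cnt0; have [jc|cj] := leqP j c; last first.
  have -> : iota 0 c = 0%N :: iota 1 c.-1 by case: (c) c_gt0.
  by rewrite /=; move/asboolP: h0 => ->; lia.
have -> : c = ((1 + j.-1) + (c - j))%N by lia.
rewrite !iotaD !count_cat /= add0n.
rewrite (@eq_in_count _ _ predT (iota (1 + j.-1) _)) ?count_predT ?size_iota.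
  by move/asboolP: h0 => ->; lia.
by move=> i; rewrite mem_iota => hi; apply/asboolP/hge; lia.
Qed.

Lemma delta_split (k : nat) : (k <= c)%N ->
  delta R = (len (vge 0) (colon (ringK R) (Rge k)) +
             len (colon (ringK R) (Rge k)) (ringK R))%N.
Proof.
move=> kc; rewrite /delta Rbar; apply: lenD.
- exact: ringK_fractional.
- exact: vge_fractional.
- exact: colon_sub (ringK_sub R).
- by rewrite -{1}colon_ringK; apply: colon_le => y [].
- by apply: colon_ge0; exact: vge_Rge.
Qed.

(** Splitting Rbar / R at R : Rge k, the two parts are bounded by
    [len_colon_tail] and [len_colon_le]. *)
Lemma delta_le (k j : nat) : (k <= c <= k + j)%N -> (0 < j)%N ->
  (delta R <= cm_type m * count Sb (iota 0 k) + j.-1)%N.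
Proof.
move=> hk j0; have /andP[kc _] := hk; rewrite (delta_split kc).
have := len_colon_tail hk j0.
have h : Rge k `<=` Rge 0 by rewrite Rge0 => y [].
have := len_colon_le (Rge_fractional 0) (Rge_fractional k) h.
by rewrite len_Rge // subn0 Rge0 colon_ringK; lia.
Qed.

Section Multiplicity.
Variables (x : R) (e : nat).
Hypothesis v_x : v x%:F = (e%:Z)%:E.
Hypothesis e_gt0 : (0 < e)%N.
Hypothesis e_min : forall k : nat, (0 < k)%N -> Sb k -> (e <= k)%N.

Lemma Sb_e : Sb e.
Proof. by apply/asboolP/vin_ringK; exists x%:F => //; exact: ringK_mem. Qed.

(** Multiplying by an element of m adds at least e to the value. *)
Lemma Tb_ge (k : nat) : (c <= k + e)%N -> Tb k.
Proof.
move=> ck; apply/asboolP; have [y vy] := v_exists k; exists y => //.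
rewrite embed_m => z [[a _ <-] ha]; apply: c_sub.
have [->|a0] := eqVneq a 0; first by rewrite tofrac0 mulr0; exact: vge0.
have a0' : a%:F != 0 by rewrite tofrac_eq0.
have [l va l1] := vge_fin a0' ha.
apply: (@vgeW _ (k%:Z + l)); last exact: vge_of_eq (vMk vy va).
have : (e <= `|l|)%N.
  apply: e_min; first by lia.
  apply/asboolP/vin_ringK; exists a%:F; first exact: ringK_mem.
  by rewrite va; congr (_%:E); lia.
by lia.
Qed.

(** Below c the elements of the conductor do not affect the value of g + x a. *)
Lemma vin_cond_plus (k : nat) : (k < c)%N ->
  vin (cond_plus x) k%:Z <-> (e <= k)%N /\ Sb (k - e).
Proof.
move=> kc; split.
  move=> [_ [g hg [a _ <-]] vk]; rewrite conductorE in hg.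
  have vxa : v (x * a)%:F = k%:Z%:E.
    have -> : (x * a)%:F = (g + (x * a)%:F) + - g by rewrite addrC addKr.
    by apply: v_dom => //; apply: vgeN; apply: vgeW hg; lia.
  have := v_neq0 vxa; rewrite tofracM mulf_eq0 negb_or => /andP[x0 a0].
  have [l va] := v_fin a0; have l0 : 0 <= l by apply/(vgeE _ va).
  move: vxa; rewrite tofracM (vMk v_x va) => -[kE].
  split; first by lia.
  apply/asboolP/vin_ringK; exists a%:F; first exact: ringK_mem.
  by rewrite va; congr (_%:E); lia.
move=> [ek /asboolP/vin_ringK[_ [a _ <-] va]].
exists (x * a)%:F; last by rewrite tofracM (vMk v_x va); congr (_%:E); lia.
by exists 0; [rewrite conductorE; exact: vge0|exists a; rewrite ?add0r].
Qed.

Lemma len_cond_plus :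
  (len (ringK R) (cond_plus x) + count Sb (iota 0 (c - e)))%N = nvalues.
Proof.
have lin : cond_plus x `<=` ringK R.
  move=> _ [g hg [a _ <-]]; rewrite conductorE in hg.
  by apply: submodD; [exact: ringK_sub|exact: c_sub|exact: ringK_mem].
have w : window 0 c (cond_plus x).
  apply: window0; last by apply: subset_trans lin ringK_ge0.
  - apply: submoduleI.
    + exists 0; first by rewrite conductorE; exact: vge0.
      by exists 0 => //; rewrite mulr0 tofrac0 addr0.
    + move=> _ _ [g hg [a _ <-]] [g' hg' [a' _ <-]]; exists (g + g').
        by move: hg hg'; rewrite conductorE; exact: vgeD.
      by exists (a + a') => //; rewrite mulrDr tofracD addrACA.
    + move=> u _ [g hg [a _ <-]]; exists (u%:F * g).
        by move: hg; rewrite conductorE; apply: submodM; exact: vge_submodule.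
      by exists (u * a) => //; rewrite mulrDr -tofracM (mulrCA u x).
  - by move=> y hy; exists y; [rewrite conductorE|exists 0 => //; rewrite mulr0 tofrac0 addr0].
have := len_cnt w ringK_window lin; rewrite cnt_ringK -/nvalues => <-; congr (_ + _)%N.
rewrite cnt0; have [ec|ce] := leqP e c; last first.
  have -> : (c - e = 0)%N by lia.
  rewrite /= (@eq_in_count _ _ pred0) ?count_pred0 // => i; rewrite mem_iota add0n => /= ic.
  by apply/asboolP => /(vin_cond_plus ic)[]; lia.
have {2}-> : c = (e + (c - e))%N by lia.
rewrite iotaD count_cat (@eq_in_count _ _ pred0 (iota 0 e)) ?count_pred0; last first.
  move=> i; rewrite mem_iota add0n => /= ic; apply/asboolP => h.
  by have /(vin_cond_plus _)[] := h; lia.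
rewrite add0n -[(0 + e)%N]addnC iotaDl count_map; apply: eq_in_count => i.
rewrite mem_iota add0n => /= ic; apply/asboolP/asboolP => [/asboolP h|].
  by apply/vin_cond_plus; [lia|rewrite addKn; split=> //; lia].
by move/vin_cond_plus; rewrite addKn => -[|_ /asboolP]; first by lia.
Qed.

(** Subtracting multiples of x raises the value until it reaches c or leaves e +
    S. *)
Lemma reduce_mod_x z : ringK R z -> exists y : R,
  vge c (z - x%:F * y%:F) \/
  exists w : nat, [/\ v (z - x%:F * y%:F) = w%:Z%:E, (w < c)%N & ~ ((e <= w)%N /\ Sb (w - e))].
Proof.
move=> Rz; have [d] := vge_all z c; elim: d z Rz => [|d IH] z Rz hz.
  by exists 0; left; rewrite tofrac0 mulr0 subr0; move: hz; rewrite subr0.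
have [hc|nhc] := pselect (vge c z).
  by exists 0; left; rewrite tofrac0 mulr0 subr0.
have [z0|z0] := eqVneq z 0; first by case: nhc; rewrite z0; exact: vge0.
have [l vz l0] := vge_fin z0 (ringK_ge0 Rz).
have lE : l = `|l|%N by lia.
rewrite lE in vz; set w := `|l|%N in vz.
have wc : (w < c)%N by rewrite ltnNge; apply/negP => h; apply/nhc/(vgeE _ vz); lia.
have [[ew /asboolP/vin_ringK[_ [a _ <-] va]]|nw] :=
  pselect ((e <= w)%N /\ Sb (w - e)); last first.
  by exists 0; right; exists w; rewrite tofrac0 mulr0 subr0.
have vxa : v (x%:F * a%:F) = w%:Z%:E by rewrite (vMk v_x va); congr (_%:E); lia.
have [u hu] := cancel_lead vz vxa.
have [||y hy] := IH (z - u%:F * (x%:F * a%:F)).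
- apply: submodB => //; first exact: ringK_sub.
  by apply: submodM; [exact: ringK_sub|rewrite -tofracM; exact: ringK_mem].
- apply: vgeW hu; move/(vgeE _ vz): hz; lia.
exists (u * a + y); rewrite tofracD tofracM mulrDr opprD addrA.
by rewrite mulrCA.
Qed.

(** Let y have value w. Since w - e is not a value of R : m, the quotient y / x
    does not multiply m into R, so y z is outside xR for some z in m. Reduce z
    modulo xR; if its value w' were at least c + e - w, then y z / x would have
    value at least c. *)
Lemma small_sum w : Sb w -> (e <= w)%N -> ~~ Tb (w - e) ->
  exists w', [/\ Sb w', (0 < w' < c)%N, ~~ ((e <= w')%N && Sb (w' - e)) & (w + w' < c + e)%N].
Proof.
move=> /asboolP/vin_ringK[y Ry vy] ew nT; apply: contrapT => no.
move/asboolP: nT; apply.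
have x0 := v_neq0 v_x.
exists (y / x%:F); last by rewrite (vMk vy (vV v_x)); congr (_%:E); lia.
rewrite embed_m => z [Rz hz]; have [u hu] := reduce_mod_x Rz.
have yxu : y * (x%:F * u%:F) / x%:F = y * u%:F by rewrite [x%:F * _]mulrC mulrA mulfK.
rewrite mulrAC -(subrK (x%:F * u%:F) z) mulrDr mulrDl yxu.
apply: submodD; [exact: ringK_sub| |by apply: ringK_mul => //; exact: ringK_mem].
apply: c_sub; set z' := z - _ in hu *.
have Rz' : ringK R z'.
  by apply: submodB => //; [exact: ringK_sub|rewrite -tofracM; exact: ringK_mem].
have hz' : vge 1 z'.
  apply: vgeB => //; rewrite -[1](_ : 1 + 0 = 1) //; apply: vgeM => //.
  by apply/(vgeE _ v_x); lia.
have key (k : nat) : vge k z' -> (c + e <= w + k)%N -> vge c (y * z' / x%:F).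
  move=> hk wk; apply: (@vgeW _ (w%:Z + k%:Z - e%:Z)); first by lia.
  by apply: vgeM; [apply: vgeM => //; exact: vge_of_eq|exact: vge_of_eq (vV v_x)].
case: hu => [hc|[k [vk kc nk]]]; first by apply: (key c) => //; lia.
have k0 : (0 < k)%N by move/(vgeE _ vk): hz'; lia.
apply: (key k); first exact: vge_of_eq.
rewrite leqNgt; apply/negP => wk; apply: no; exists k; split=> //.
- by apply/asboolP/vin_ringK; exists z'.
- by rewrite k0.
- by apply/negP => /andP.
Qed.

End Multiplicity.

(** * The type sequence *)

Section TypeSequence.
Variable s : nat -> nat.
Hypothesis s_incr : {homo s : i j / (i < j)%N}.
Hypothesis s_range : range s = value_set v.

Lemma Sb_s (j : nat) : Sb (s j).
Proof. by apply/asboolP; rewrite -s_range; exists j. Qed.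

Lemma s_surj (k : nat) : Sb k -> exists j, s j = k.
Proof. by move/asboolP; rewrite -s_range => -[j _ <-]; exists j. Qed.

Lemma s_lt (i j : nat) : (s i < s j)%N = (i < j)%N.
Proof.
apply/idP/idP; last exact: s_incr.
by rewrite !ltnNge; apply: contra; rewrite leq_eqVlt => /orP[/eqP->//|/s_incr/ltnW].
Qed.

Lemma s0 : s 0 = 0%N.
Proof.
have [j] := s_surj Sb0; case: j => [//|j sj].
by have := s_incr (ltn0Sn j); rewrite sj.
Qed.

Lemma count_gap (j : nat) : count Sb (iota (s j) (s j.+1 - s j)) = 1%N.
Proof.
have lt := s_incr (ltnSn j).
have -> : (s j.+1 - s j = 1 + (s j.+1 - s j).-1)%N by lia.
rewrite iotaD count_cat /= Sb_s (@eq_in_count _ _ pred0) ?count_pred0 // => i.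
rewrite mem_iota => hi; apply/negP => /s_surj[l li].
have h1 : (s j < s l)%N by lia.
have h2 : (s l < s j.+1)%N by lia.
by move: h1 h2; rewrite !s_lt; lia.
Qed.

(** The elements of S below s_j are s_0, ..., s_(j-1). *)
Lemma count_s (j : nat) : count Sb (iota 0 (s j)) = j.
Proof.
elim: j => [|j IH]; first by rewrite s0.
have lt := s_incr (ltnSn j).
have -> : s j.+1 = (s j + (s j.+1 - s j))%N by lia.
by rewrite iotaD count_cat IH add0n count_gap addn1.
Qed.

Lemma le_s (k j : nat) : (count Sb (iota 0 k) <= j)%N -> (k <= s j)%N.
Proof.
move=> h; rewrite leqNgt; apply/negP => sk; have := count_s j.+1.
have lt := s_incr (ltnSn j).
suff : (count Sb (iota 0 (s j).+1) <= count Sb (iota 0 k))%N.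
  by rewrite -addn1 iotaD count_cat count_s /= Sb_s; lia.
have -> : k = ((s j).+1 + (k - (s j).+1))%N by lia.
by rewrite iotaD count_cat leq_addr.
Qed.

Lemma s_nS : s nvalues = c.
Proof. by have [j sj] := s_surj (Sb_ge (leqnn c)); rewrite /nvalues -sj count_s. Qed.

Lemma s_le_c (j : nat) : (j <= nvalues)%N -> (s j <= c)%N.
Proof. by move=> jn; rewrite -s_nS leqNgt s_lt -leqNgt. Qed.

Lemma embed_filt (i : nat) : embed (filt v s i) = Rge (s i).
Proof.
apply/seteqP; split=> [_ [a ha <-]|_ [[a _ <-] ha]]; last by exists a.
by split=> //; exact: ringK_mem.
Qed.

Lemma type_term_le (i : nat) : (0 < i <= nvalues)%N -> (type_term v s i <= cm_type m)%N.
Proof.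
case: i => // i /andP[_ iS]; rewrite /type_term !embed_filt /=.
have lt := s_incr (ltnSn i).
have le : Rge (s i.+1) `<=` Rge (s i) by move=> y [Ry hy]; split=> //; apply: vgeW hy; lia.
have := len_colon_le (Rge_fractional _) (Rge_fractional _) le.
by rewrite len_Rge ?count_gap ?muln1 // s_le_c // ltnW.
Qed.

(** The first positive value is s_1, so that the elements of value at least s_1
    form m. *)
Lemma type_term1 : type_term v s 1 = cm_type m.
Proof.
rewrite /type_term !embed_filt /= s0 Rge0 colon_ringK.
have -> // : Rge (s 1) = embed m.
rewrite embed_m; have lt : (0 < s 1)%N by rewrite -{1}s0; exact: s_incr.
apply/seteqP; split=> y [Ry hy]; split=> //; first by apply: vgeW hy; lia.
have [->|y0] := eqVneq y 0; first exact: vge0.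
have [l vy l1] := vge_fin y0 hy; apply/(vgeE _ vy).
have /s_surj[j sj] : Sb `|l|.
  by apply/asboolP/vin_ringK; exists y => //; rewrite vy; congr (_%:E); lia.
have : (s 0 < s j)%N by rewrite s0; lia.
rewrite s_lt; case: j sj => // j sj _.
have : (s 1 <= s j.+1)%N by rewrite leqNgt s_lt.
by lia.
Qed.

Lemma sum_type_terms (j : nat) : (j <= nvalues)%N ->
  sumn [seq type_term v s i | i <- iota 1 j] =
  len (colon (ringK R) (Rge (s j))) (ringK R).
Proof.
elim: j => [|j IH] jS.
  by rewrite s0 Rge0 colon_ringK lenxx //; exact: ringK_fractional.
rewrite -(addn1 j) iotaD map_cat sumn_cat /= addn0 IH ?(ltnW jS) //.
rewrite /type_term !embed_filt /= add1n addn1.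
have lt := s_incr (ltnSn j).
have le : Rge (s j.+1) `<=` Rge (s j) by move=> y [Ry hy]; split=> //; apply: vgeW hy; lia.
rewrite addnC; apply/esym/lenD.
- exact: ringK_fractional.
- by apply: colon_fractional; exact: Rge_fractional.
- exact: colon_sub (ringK_sub R).
- by rewrite -{1}colon_ringK; apply: colon_le => y [].
- exact: colon_le.
Qed.

Lemma sum_type_seq : sumn (type_seq v s) = delta R.
Proof.
by rewrite /type_seq len_ringK_conductor sum_type_terms // s_nS colon_Rgec /delta Rbar.
Qed.

Lemma size_type_seq : size (type_seq v s) = nvalues.
Proof. by rewrite /type_seq size_map size_iota len_ringK_conductor. Qed.

Lemma nseq_of_sum (r : nat) (l : seq nat) : all (leq^~ r) l ->
  (r * size l <= sumn l)%N -> l = nseq (size l) r.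
Proof.
elim: l => [//|a l IH] /= /andP[ar al] h.
have hl : (sumn l <= r * size l)%N.
  by elim: l al {IH h} => [//|b l IH] /= /andP[br /IH]; lia.
have -> : a = r by lia.
by congr cons; apply: IH => //; lia.
Qed.

(** The first k terms are at most r and the others add up to at most j - 1. When
    delta is as large as this allows, all these bounds are equalities. *)
Lemma type_seq_rigid (k j : nat) : (k <= nvalues)%N -> (c <= s k + j)%N -> (0 < j)%N ->
  (cm_type m * k + j.-1 <= delta R)%N ->
  [/\ type_seq v s = nseq k (cm_type m) ++
        [seq type_term v s i | i <- iota k.+1 (nvalues - k)] &
      sumn [seq type_term v s i | i <- iota k.+1 (nvalues - k)] = j.-1].
Proof.
move=> kS ckj j0 hd; set l2 := [seq _ | _ <- _].
pose l1 := [seq type_term v s i | i <- iota 1 k].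
have E : type_seq v s = l1 ++ l2.
  by rewrite /type_seq len_ringK_conductor -{1}(subnKC kS) iotaD map_cat add1n.
have := sum_type_seq; rewrite E sumn_cat => Es.
have sz : size l1 = k by rewrite size_map size_iota.
have l1r : all (leq^~ (cm_type m)) l1.
  by apply/allP => _ /mapP[i + ->]; rewrite mem_iota => hi; apply: type_term_le; lia.
have tail : (sumn l2 <= j.-1)%N.
  have := len_colon_tail (k := s k) (j := j); rewrite ckj s_le_c // => /(_ isT j0).
  have := delta_split (s_le_c kS); rewrite -sum_type_terms // -Es -/l1.
  by lia.
have l1E : l1 = nseq k (cm_type m) by rewrite -sz; apply: nseq_of_sum => //; rewrite sz; lia.
split; first by rewrite -l1E.
by move: Es; rewrite l1E sumn_nseq; lia.
Qed.

End TypeSequence.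

(** * Type one implies Gorenstein *)

Section TypeOne.
Hypothesis type1 : cm_type m = 1%N.

Lemma colon_scalem a : a != 0 ->
  colon (ringK R) (scalem a (ringK R)) = scalem a^-1 (ringK R).
Proof.
move=> a0; apply/seteqP; split=> [y hy|_ [z Rz <-] _ [u Ru <-]].
  exists (a * y); last by rewrite mulKf.
  rewrite mulrC; apply: hy; exists 1; rewrite ?mulr1 //.
  by rewrite -tofrac1; exact: ringK_mem.
by rewrite mulrACA mulVf // mul1r; exact: ringK_mul.
Qed.

(** The modules R / aR and a^-1 R / R have the same length, and for r = 1 no
    step between aR and R gains length under J |-> R : J. Hence no step can lose
    any either. *)
Lemma colon_strict a J J' : ringK R a -> a != 0 -> submodule J -> submodule J' ->
  scalem a (ringK R) `<=` J -> J `<` J' -> J' `<=` ringK R ->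
  ~ (colon (ringK R) J `<=` colon (ringK R) J').
Proof.
move=> Ra a0 sJ sJ' AJ JJ' J'R hle; set A := scalem a _ in AJ.
have fR := ringK_fractional; have fA : fractional A by exact: fractional_scale.
have JR := subset_trans JJ'.1 J'R.
have fJ := fractional_mid sJ AJ JR fA fR.
have fJ' := fractional_mid sJ' (subset_trans AJ JJ'.1) J'R fA fR.
have EQ : colon (ringK R) J = colon (ringK R) J'.
  by apply/seteqP; split=> //; apply: colon_le; case: JJ'.
have := len_gt0 fJ fJ' JJ'.
have fcA := colon_fractional fA; have fcJ := colon_fractional fJ.
have h1 := len_colon_le fJ fA AJ; have h2 := len_colon_le fR fJ' J'R.
rewrite type1 !mul1n -EQ colon_ringK in h1 h2.
have RJ : ringK R `<=` colon (ringK R) J by rewrite -{1}colon_ringK; apply: colon_le.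
have l1 := lenD fR fcA (fractional_sub fcJ) RJ (colon_le AJ).
have l2 := lenD fA fR sJ' (subset_trans AJ JJ'.1) J'R.
have l3 := lenD fA fJ' sJ AJ JJ'.1.
suff : len (colon (ringK R) A) (ringK R) = len (ringK R) A by lia.
rewrite colon_scalem //; set B := scalem a^-1 _.
have AB : scalem a B = ringK R.
  apply/seteqP; split=> [_ [_ [y Ry <-] <-]|y Ry]; first by rewrite mulVKf.
  by exists (a^-1 * y); [exists y|rewrite mulVKf].
have RB : ringK R `<=` B.
  by move=> y Ry; exists (a * y); [exact: ringK_mul|rewrite mulKf].
have fB : fractional B by apply: fractional_scale; rewrite ?invr_eq0.
by rewrite -(len_scale a0 fR fB RB) AB.
Qed.

(** For r = 1 the module (R : m) / R is simple. *)
Lemma Rm_line w : Rm w -> ~ ringK R w -> Rm `<=` addm (ringK R) (line w).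
Proof.
move=> hw nw y hy; apply: contrapT => ny.
have fR := ringK_fractional; have fM := Rm_fractional; have sM := fractional_sub fM.
have sub : addm (ringK R) (line w) `<=` Rm.
  by apply: addm_le => //; [exact: ringK_Rm|exact: line_le].
have sN : submodule (addm (ringK R) (line w)).
  by apply: addm_sub; [exact: ringK_sub|exact: line_sub].
have RN : ringK R `<=` addm (ringK R) (line w) by apply: addm_l; exact: line_sub.
have fN := fractional_mid sN RN sub fR fM.
have := lenD fR fM sN RN sub; rewrite -/(cm_type m) type1.
have : (0 < len (addm (ringK R) (line w)) (ringK R))%N.
  apply: len_gt0 => //; split=> // /(_ w) h; apply/nw/h.
  by apply: addm_r; [exact: ringK_sub|exact: line_mem].
have : (0 < len Rm (addm (ringK R) (line w)))%N.
  by apply: len_gt0 => //; split=> // /(_ _ hy).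
by lia.
Qed.

Section ExtendHom.
Variables (I : set R) (phi : R -> K_mod_R R).
Hypothesis sI : ideal I.
Hypothesis phiD : forall a b, I a -> I b -> phi (a + b) = phi a + phi b.
Hypothesis phiM : forall a b, I b -> phi (a * b) = a *: phi b.

Lemma embed_ideal : submodule (embed I).
Proof.
have [I0 Il] := (submoduleP _).1 sI; apply: submoduleI.
- by exists 0; rewrite ?tofrac0.
- move=> _ _ [a Ia <-] [b Ib <-]; exists (a + b); rewrite ?tofracD //.
  by have := Il 1 a b Ia Ib; rewrite scale1r.
- move=> a _ [b Ib <-]; exists (a * b); rewrite ?tofracM //.
  by have := Il a b 0 Ib I0; rewrite addr0.
Qed.

Lemma embedP (A : set R) a : embed A a%:F <-> A a.
Proof. by split=> [[b Ab /eqP]|Aa]; [rewrite tofrac_eq => /eqP <-|exists a]. Qed.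

(** Subtracting multiplication by q from phi gives a map that vanishes on J; its
    value at b is killed by m, so it is the class of an element z of R : m. By
    [colon_strict] some w in R : J does not multiply b into R; then w b
    generates R : m modulo R, and a multiple of w corrects q without changing it
    on J. *)
Lemma extend_hom J b q : submodule J -> J `<=` embed I -> I b -> ~ J b%:F ->
  (exists2 a, scalem a (ringK R) `<=` J & ringK R a /\ a != 0) ->
  (forall u : R, vge 1 u%:F -> J (u%:F * b%:F)) ->
  (forall a, J a%:F -> phi a = a *: q) ->
  exists q', forall a, addm J (line b%:F) a%:F -> phi a = a *: q'.
Proof.
move=> sJ JI Ib nJb [a0 AJ [Ra0 a0n]] mb hq; set N := addm _ _.
have sN : submodule N by apply: addm_sub => //; exact: line_sub.
have embR : embed I `<=` ringK R by move=> _ [y _ <-]; exact: ringK_mem.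
have JN : J `<=` N by apply: addm_l; exact: line_sub.
have Nb : N b%:F by apply: addm_r => //; exact: line_mem.
have NI : N `<=` embed I.
  have sEI := embed_ideal.
  by apply: addm_le => //; apply: line_le => //; exact/embedP.
have JltN : J `<` N by split=> // /(_ _ Nb).
have := colon_strict Ra0 a0n sJ sN AJ JltN (subset_trans NI embR).
move=> /existsNP[w /not_implyP[hwJ nwN]].
have nwb : ~ ringK R (w * b%:F).
  move=> h; apply: nwN => _ [j Jj [_ [u _ <-] <-]].
  rewrite mulrDr; apply: submodD; [exact: ringK_sub|exact: hwJ|].
  by rewrite mulrCA; apply: submodM => //; exact: ringK_sub.
have hwb : Rm (w * b%:F).
  by rewrite embed_m => _ [[u _ <-] hu]; rewrite mulrAC -mulrA; apply: hwJ; exact: mb.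
have [z zE] := toquot_surj (phi b - b *: q).
have hz : Rm z.
  rewrite embed_m => _ [[u _ <-] hu]; apply/toquot_eq0.
  rewrite mulrC -scale_toquot zE scalerBr -phiM // hq ?tofracM; last exact: mb.
  by rewrite scalerA subrr.
have [rho Rrho [_ [u _ <-] zE']] := Rm_line hwb nwb hz.
exists (q + toquot (u%:F * w)) => a Na.
have [j Jj [_ [d _ <-] aE]] := Na.
have jE : j = (a - d * b)%:F by rewrite tofracB tofracM -aE addrK.
rewrite jE in Jj.
have Iab : I (a - d * b) by apply/embedP/JI.
have Idb : I (d * b).
  by apply/embedP; rewrite tofracM; apply: submodM; [exact: embed_ideal|exact/embedP].
have -> : phi a = phi (a - d * b) + d *: phi b by rewrite -phiM // -phiD // subrK.
rewrite hq // -[phi b](subrK (b *: q)) -zE -zE' toquotD.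
rewrite (toquot_eq0 rho).2 // add0r.
have wj : (a - d * b) *: toquot (u%:F * w) = 0.
  rewrite scale_toquot; apply/toquot_eq0; rewrite mulrCA [_ * w]mulrC.
  by apply: submodM; [exact: ringK_sub|exact: hwJ].
have -> : toquot (u%:F * (w * b%:F)) = b *: toquot (u%:F * w).
  by rewrite scale_toquot mulrA mulrC.
rewrite -scalerDr scalerA addrC -[_ *: q](addr0) -wj -scalerDr addrC.
by rewrite -[toquot _ + q]addrC -scalerDl subrK.
Qed.

(** Start with a principal ideal aR inside I, where division by a gives q, and
    adjoin elements by simple steps until I is reached. *)
Lemma hom_is_mult : exists q, forall a, I a -> phi a = a *: q.
Proof.
have [I0 Il] := (submoduleP _).1 sI.
have [[a [Ia a0]]|no] := pselect (exists a, I a /\ a != 0); last first.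
  exists 0 => a Ia; have -> : a = 0.
    by apply/eqP; apply: contrapT => /negP a0; apply: no; exists a.
  by have := phiM 0 I0; rewrite mul0r !scale0r.
have a0' : a%:F != 0 by rewrite tofrac_eq0.
set A := scalem a%:F (ringK R).
have embR : embed I `<=` ringK R by move=> _ [y _ <-]; exact: ringK_mem.
have AI : A `<=` embed I.
  move=> _ [_ [y _ <-] <-]; rewrite mulrC; apply: submodM; first exact: embed_ideal.
  exact/embedP.
have fA : fractional A by apply: fractional_scale => //; exact: ringK_fractional.
have fI := fractional_mid embed_ideal AI embR fA ringK_fractional.
suff H d J : len (embed I) J = d -> fractional J -> A `<=` J -> J `<=` embed I ->
    (exists q, forall b, J b%:F -> phi b = b *: q) ->
    exists q, forall b, I b -> phi b = b *: q.
  apply: (H _ A erefl) => //; have [y yE] := toquot_surj (phi a).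
  exists (toquot (y / a%:F)) => b [_ [u _ <-] /eqP].
  rewrite -tofracM tofrac_eq => /eqP <-.
  rewrite mulrC phiM // -yE !scale_toquot tofracM; congr toquot.
  by rewrite -mulrA [a%:F * _]mulrC divfK.
elim: d J => [|d IH] J Ed fJ AJ JI [q hq].
  exists q => b Ib; apply: hq; apply: contrapT => nb.
  have : (0 < len (embed I) J)%N.
    by apply: len_gt0 => //; split=> // /(_ b%:F) h; apply/nb/h; exact/embedP.
  by rewrite Ed.
have JltI : J `<` embed I.
  split=> // IJ; have JE : J = embed I by exact/seteqP.
  by move: Ed; rewrite JE lenxx.
have [b [fN [JN NJ] NI l1 [nb mb]]] := len_grow fJ fI JltI.
have : embed I b by apply: NI; apply: addm_r; [exact: fractional_sub|exact: line_mem].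
move=> [b' Ib' bE]; rewrite -bE in fN JN NJ NI l1 nb mb.
have lI := lenD fJ fI (fractional_sub fN) JN NI.
apply: (IH _ _ fN) => //; first by lia.
  exact: subset_trans AJ JN.
apply: (extend_hom (q := q)) => //; first exact: fractional_sub.
by exists a%:F => //; split=> //; exact: ringK_mem.
Qed.

End ExtendHom.

Lemma type1_gorenstein : gorenstein R.
Proof. by apply: quot_baer_gorenstein => I phi sI; exact: hom_is_mult. Qed.

End TypeOne.

(** * The equivalences *)

Lemma value_setE (L : seq nat) (c' : nat) :
  value_set v = list_then L c' <-> forall k : nat, Sb k = (k \in L) || (c' <= k)%N.
Proof.
split=> [h k|h].
  apply/asboolP/idP; first by rewrite h.
  by move=> hk; rewrite h.
apply/seteqP; split=> k /=; first by move/asboolP; rewrite -/(Sb k) h.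
by move=> hk; apply/asboolP; rewrite -/(Sb k) h.
Qed.

Section Equivalences.
Variables (x : R) (s : nat -> nat) (e p : nat).
Hypothesis s_incr : {homo s : i j / (i < j)%N}.
Hypothesis s_range : range s = value_set v.
Hypothesis v_x : v x%:F = (e%:Z)%:E.
Hypothesis e_gt0 : (0 < e)%N.
Hypothesis e_min : forall k : nat, (0 < k)%N -> Sb k -> (e <= k)%N.
Hypothesis p_bounds : (c - e <= p * e < c)%N.
Hypothesis p_gt0 : (1 <= p)%N.
Hypothesis not_gorenstein : ~ gorenstein R.

Let r := cm_type m.
Let lx := len (ringK R) (cond_plus x).
Let n := nvalues.
Let d := delta R.

Lemma ring_data : semigroup_data Sb Tb c e p n r lx d.
Proof.
split.
- exact: Sb0.
- exact: SbD.
- exact: Sb_ge.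
- exact: Sb_pred_c.
- exact: Sb_e v_x.
- exact: e_min.
- exact: Tb_S.
- exact: S_Tb.
- by move=> k; apply: Tb_ge.
- exact: p_bounds.
- exact: p_gt0.
- by [].
- exact: typeE.
- by apply: (len_cond_plus v_x).
- exact: deltaE.
- exact: delta_le.
- by apply: (small_sum v_x).
Qed.

Lemma r_gt1 : (1 < r)%N.
Proof.
have := type_gt0 ring_data; rewrite leq_eqVlt => /orP[/eqP r1|//].
by case: not_gorenstein; apply: type1_gorenstein.
Qed.

Lemma b_invE : b_inv m + c%:Z = (r * n + n)%N%:Z.
Proof.
by rewrite /b_inv cond_lenE; have := deltaE; rewrite -/r -/n -/d; lia.
Qed.

Local Notation tt i := (type_term v s i).

(** For l = 1 the bound on delta, taken at s_(n-1) = p e with j = c - p e, is an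
    equality. *)
Lemma type_seq_l1 : lx = 1%N ->
  type_seq v s = rcons (nseq n.-1 (e - 1)%N) (tt n) /\ tt n = (c - p * e - 1)%N.
Proof.
move=> l1; have nE := shape1_n ring_data l1; have rE := shape1_r ring_data l1.
have pc : (p * e < c)%N by case/andP: p_bounds.
have ps : (p * e <= s p)%N.
  apply: (le_s s_incr s_range); have := erefl n; rewrite {2}/n /nvalues.
  have {1}-> : c = (p * e + (1 + (c - p * e).-1))%N by lia.
  by rewrite !iotaD !count_cat add0n /= (S_mult ring_data) nE; lia.
have [||||E1 E2] := type_seq_rigid s_incr s_range (k := p) (j := c - p * e).
- by rewrite -/n nE.
- by lia.
- by lia.
- have := deltaE; rewrite -/n -/d -/r nE rE => dE.
  have : (e.-1 * p + p = p * e)%N by rewrite -mulSnr prednK // mulnC.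
  by lia.
move: E1 E2; rewrite -/n nE subSnn /= -/r rE addn0 subn1 => -> ->; rewrite -cats1.
by split=> //; lia.
Qed.

(** For b = r - 1 and l = 2 the bound on delta, taken at s_(n-2) >= c - e with j
    = e, is an equality. *)
Lemma type_seq_l2 (g : nat) : lx = 2%N -> (r + 2)%N = e -> (r * n + n + 1 = c + r)%N ->
  n = g.+2 -> type_seq v s = nseq g (e - 2)%N ++ [:: tt g.+1; tt g.+2] /\
  (tt g.+1 + tt g.+2 = e - 1)%N.
Proof.
move=> l2 re fE nE.
have gs : (c - e <= s g)%N.
  apply: (le_s s_incr s_range); have := len_cond_plus v_x e_gt0.
  by rewrite -/lx l2 -/n nE; lia.
have [||||E1 E2] := type_seq_rigid s_incr s_range (k := g) (j := e).
- by rewrite -/n nE; lia.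
- by lia.
- exact: e_gt0.
- by have := deltaE; rewrite -/n -/d -/r nE; move: fE; rewrite nE !mulnS; lia.
have gE : (g.+2 - g = 2)%N by rewrite -addn2 addKn.
move: E1 E2; rewrite -/n nE gE /= -/r addn0 => -> ->; rewrite subn1.
by have -> : r = (e - 2)%N by lia.
Qed.

Lemma type_of_type_seq (a : nat) (l : seq nat) : type_seq v s = a :: l -> r = a.
Proof.
have := type_term1 s_incr s_range; rewrite /type_seq len_ringK_conductor -/n -/r.
by case: n => [//|k] /= -> [].
Qed.

Lemma n_of_type_seq : size (type_seq v s) = n.
Proof. exact: size_type_seq. Qed.

Lemma n_gt1 : (1 < n)%N.
Proof.
have ec := mult_lt_c ring_data; rewrite /n /nvalues.
have -> : c = (1 + (e.-1 + (1 + (c - e.+1))))%N by lia.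
rewrite !iotaD !count_cat /= Sb0; have -> : (0 + 1 + e.-1 = e)%N by lia.
by rewrite (Sb_e v_x); lia.
Qed.

Lemma b_of_type_seq (z : nat) : type_seq v s = rcons (nseq n.-1 (e - 1)%N) z ->
  (r + 1 = e)%N /\ (r * n + n + z + 1 = c + e)%N.
Proof.
move=> tsE; have n1 := n_gt1; have := sum_type_seq s_incr s_range.
have rE : r = (e - 1)%N.
  by case: n n1 tsE => [|[|k]] // _ tsE; exact: type_of_type_seq tsE.
rewrite tsE sumn_rcons sumn_nseq -rE => dE; have := deltaE; rewrite -dE -/n.
have re : (r + 1 = e)%N by lia.
by move=> cE; split=> //; move: cE; case: n n1 => // k _ /=; rewrite !mulnS; lia.
Qed.

Lemma equivalences :
  let b := b_inv m in
  let vR := value_set v in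
  let ts := type_seq v s in
  let r_ i := type_term v s i in
  let multiples := [seq (i * e)%N | i <- iota 0 p.+1] in
  ([/\ b < r%:Z - 1 <->
         vR = list_then multiples c /\ (p * e + 2 < c <= (p + 1) * e)%N,
       b < r%:Z - 1 <->
         ts = rcons (nseq n.-1 (e - 1)%N) (r_ n) /\ (1 < r_ n)%N &
       b < r%:Z - 1 ->
         [/\ lx = 1%N, c%:Z = (p%:Z + 1) * e%:Z - b, r%:Z = e%:Z - 1 &
             (r_ n)%:Z = e%:Z - 1 - b]]) /\
  ([/\ b = r%:Z - 1 -> r%:Z = e%:Z - 1 \/ r%:Z = e%:Z - 2,
       [/\ b = r%:Z - 1 /\ b = e%:Z - 2 <->
             vR = list_then multiples c /\ c = (p * e + 2)%N,
           b = r%:Z - 1 /\ b = e%:Z - 2 <->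
             ts = rcons (nseq n.-1 (e - 1)%N) 1%N &
           b = r%:Z - 1 /\ b = e%:Z - 2 -> lx = 1%N] &
       [/\ b = r%:Z - 1 /\ b = e%:Z - 3 <->
             vR = list_then [:: 0; e; 2 * e - 1; 2 * e]%N (3 * e - 1) \/
             (exists2 y : nat, (e < y)%N && (2 * (y - e) <= e - 1)%N &
                vR = list_then [:: 0; e; y]%N (2 * e)),
           b = r%:Z - 1 /\ b = e%:Z - 3 <->
             (ts = [:: e - 2; e - 2; r_ 3; r_ 4]%N /\
                (r_ 3 + r_ 4 = e - 1)%N) \/
             (ts = [:: e - 2; r_ 2; r_ 3]%N /\ (r_ 2 + r_ 3 = e - 1)%N) &
           b = r%:Z - 1 /\ b = e%:Z - 3 -> lx = 2%N]]) /\
  (b = r%:Z ->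
     let case_g := r%:Z = e%:Z - 2 /\ lx = 2%N in
     let case_j := [/\ r = 2%N, e = 5%N & lx = 3%N] in
     [/\ case_g \/ case_j,
         case_g ->
           [\/ vR = list_then [:: 0; 4; 8; 9; 12; 13]%N 16,
               vR = list_then [:: 0; 4; 8; 11; 12; 15; 16]%N 19,
               (4 <= e)%N /\
                 vR = list_then [:: 0; e; 2 * e - 2; 2 * e]%N (3 * e - 2) |
               (4 <= e)%N /\
                 exists2 z : nat, (0 < z)%N && (2 * z <= e - 2)%N &
                   vR = list_then [:: 0; e; e + z]%N (2 * e - 1)] &
         case_j ->
           [\/ vR = list_then [:: 0; 5; 6; 7]%N 10,
               vR = list_then [:: 0; 5; 6; 8]%N 10 |
               vR = list_then [:: 0; 5; 8; 9; 10]%N 13]]).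
Proof.
move=> b vR ts r_ mult.
have D := ring_data; have r1 := r_gt1; have bE : b + c%:Z = (r * n + n)%N%:Z := b_invE.
set f := (r * n + n)%N in bE.
have /andP[_ pc] := p_bounds.
have cp : (c <= p * e + e)%N by have := p_bounds; lia.
have L1 : lx = 1%N -> [/\ f = (p * e + e)%N, (r + 1 = e)%N, vR = list_then mult c &
    [/\ ts = rcons (nseq n.-1 (e - 1)%N) (r_ n), r_ n = (c - p * e - 1)%N & (p * e + 1 < c)%N]].
  move=> l1; have [h1 h2] := type_seq_l1 l1; split.
  - by rewrite (mulnC p); exact: rnn_of_l1 D l1.
  - by rewrite (shape1_r D l1) addn1 prednK.
  - by apply/value_setE; exact: shape1 D l1.
  - by split=> //; exact: c_gt1_l1 D l1.
have V1 : vR = list_then mult c -> lx = 1%N by move/value_setE/(shape1_l D).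
have Lt : b < r%:Z - 1 -> lx = 1%N.
  by move=> h; apply: (l1_of_small_b D r1); rewrite -/f; lia.
have pe : ((p + 1) * e = p * e + e)%N by rewrite mulnDl mul1n.
have EQ1 : b = r%:Z - 1 -> (f + 1 = c + r)%N by lia.
have R1 : b = r%:Z - 1 -> (lx = 1%N /\ (r + 1 = e)%N) \/ (lx = 2%N /\ (r + 2 = e)%N).
  by move/EQ1; exact: (r_of_b_pred D r1).
have rev1 (z : nat) : ts = rcons (nseq n.-1 (e - 1)%N) z -> (r + 1 = e)%N /\ b = e%:Z - 1 - z%:Z.
  by move/b_of_type_seq; rewrite -/f => -[h1 h2]; split=> //; lia.
split; [|split].
- split.
  + split=> [h|[/V1 /L1[fE re _ [_ _ _]] h]]; last by lia.
    by have [fE re vE [_ _ hc]] := L1 (Lt h); split=> //; rewrite pe; lia.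
  + split=> [h|[/rev1[re bz] h]]; last by lia.
    by have [fE re vE [tE rn hc]] := L1 (Lt h); split=> //; rewrite rn; lia.
  + move=> h; have [fE re vE [tE rn hc]] := L1 (Lt h).
    by split; [exact: Lt| | |rewrite rn]; lia.
- split.
  + by move/R1; lia.
  + have F : b = r%:Z - 1 /\ b = e%:Z - 2 -> lx = 1%N.
      by move=> [h1 h2]; case: (R1 h1) => -[]; lia.
    split=> //.
    * split=> [h|[/V1 /L1[fE re _ [_ _ _]] h]]; last by lia.
      by have [fE re vE [_ _ hc]] := L1 (F h); split=> //; lia.
    * split=> [h|/rev1[re bz]]; last by lia.
      by have [fE re vE [tE rn hc]] := L1 (F h); rewrite tE rn; congr (rcons _ _); lia.
  + have F : b = r%:Z - 1 /\ b = e%:Z - 3 -> [/\ lx = 2%N, (r + 2 = e)%N & (f + 1 = c + r)%N].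
      move=> [h1 h2]; case: (R1 h1) => -[l2 re]; first by exfalso; lia.
      by split=> //; exact: EQ1.
    have G : (r + 2 = e)%N -> (f + 1 = c + r)%N -> b = r%:Z - 1 /\ b = e%:Z - 3 by lia.
    split.
    * split=> [/F[_ re fE]|].
        have [h|[y hy h]] := shapes_b_pred D r1 re fE.
          by left; apply/value_setE.
        by right; exists y => //; apply/value_setE.
      case=> [/value_setE/(invariants_4_values D r1)[_ re fE]|]; first exact: G.
      case=> y /andP[y1 y2] /value_setE/(invariants_3_values D r1 y1 y2)[_ re fE].
      exact: G.
    * split=> [/F[l2 re fE]|].
        have [h|[y /andP[y1 y2] h]] := shapes_b_pred D r1 re fE.
          have [n4 _ _] := invariants_4_values D r1 h.
          by left; have [h1 h2] := type_seq_l2 l2 re fE n4.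
        have [n3 _ _] := invariants_3_values D r1 y1 y2 h.
        by right; have [h1 h2] := type_seq_l2 l2 re fE n3.
      have dE := deltaE; have sE := sum_type_seq s_incr s_range; have nE := n_of_type_seq.
      rewrite -/ts in sE nE.
      case=> -[tE rr]; rewrite tE /= in sE nE; have re := type_of_type_seq tE; apply: G.
      - by lia.
      - by move: dE; rewrite /f -/n -nE -sE; lia.
      - by lia.
      - by move: dE; rewrite /f -/n -nE -sE; lia.
    * by move/F => [].
- move=> bR case_g case_j; have fE : f = (c + r)%N by lia.
  split.
  + by have [[l2 re]|[l3 r2 e5]] := r_of_b_type D r1 fE; [left; split=> //; lia|right].
  + move=> [rE l2]; have re : (r + 2 = e)%N by lia.
    have [h|h|[e4 h]|[e4 [z hz h]]] := shapes_b_type_l2 D r1 re l2 fE.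
    * by constructor 1; apply/value_setE.
    * by constructor 2; apply/value_setE.
    * by constructor 3; split=> //; apply/value_setE.
    * by constructor 4; split=> //; exists z => //; apply/value_setE.
  + move=> [r2 e5 l3]; have [h|h|h] := shapes_b_type_l3 D r1 r2 e5 l3 fE.
    * by constructor 1; apply/value_setE.
    * by constructor 2; apply/value_setE.
    * by constructor 3; apply/value_setE.
Qed.

End Equivalences.
End Values.

(** * From the hypotheses on R to the invariants *)

Lemma frac_denom (R : idomainType) (y : {fraction R}) :
  exists2 b : R, b != 0 & ringK R (b%:F * y).
Proof.
elim/quotW: y => r; exists (\d_r); first exact: denom_ratioP.
exists (\n_r) => //; unlock tofrac; rewrite -[RHS]FracField.pi_mul.
apply/eqmodP; rewrite /= FracField.equivfE.
rewrite !numden_Ratio ?mulf_neq0 ?oner_neq0 ?denom_ratioP //.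
by rewrite !mul1r mulrC.
Qed.

(** The product of the denominators. *)
Lemma common_denom (R : idomainType) (n : nat) (g : 'I_n -> {fraction R}) :
  exists2 b : R, b != 0 & forall i, ringK R (b%:F * g i).
Proof.
have h i : {b : R | b != 0 /\ ringK R (b%:F * g i)}.
  by apply: cid; have [b b0 hb] := frac_denom (g i); exists b.
exists (\prod_i sval (h i)).
  by apply/prodf_neq0 => i _; case: (svalP (h i)).
move=> i; rewrite (bigD1 i) //= mulrC tofracM mulrA [g i * _]mulrC mulrC.
by apply: submodM; [exact: ringK_sub|case: (svalP (h i))].
Qed.

Section Hypotheses.
Variables (R : idomainType) (m : set R) (t : {fraction R}).
Variable v : {fraction R} -> \bar int.
Hypothesis v_val : discrete_valuation v.
Hypothesis Rbar_dvr : int_closure R = valuation_ring v.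
Hypothesis t_unif : v t = 1%:E.
Hypothesis R_residue : residually_rational m t.

Lemma int_closure_ge : int_closure R = vge v 0.
Proof. exact: Rbar_dvr. Qed.

Lemma tofrac_ge0 (a : R) : vge v 0 a%:F.
Proof. by rewrite -int_closure_ge; exact: integral_id. Qed.

Lemma unif_idealE : unif_ideal t = vge v 1.
Proof.
apply/seteqP; split=> [_ [z hz <-]|y hy].
  rewrite int_closure_ge in hz; rewrite -[1]addr0.
  by apply: vgeM => //; exact: vge_of_eq.
have t0 := v_neq0 v_val t_unif.
exists (t^-1 * y); last by rewrite mulVKf.
rewrite int_closure_ge; have := vgeM v_val (vge_of_eq (vV v_val t_unif)) hy.
by rewrite addNr.
Qed.

Let coset_map (C : set R) : set {fraction R} :=
  [set a%:F + z | a in C & z in unif_ideal t].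

Let coset_bij : set_bij (cosets [set: R] m) (cosets (int_closure R) (unif_ideal t)) coset_map.
Proof. exact: R_residue. Qed.

Lemma residue_lift y : vge v 0 y -> exists a : R, vge v 1 (y - a%:F).
Proof.
move=> hy; have [_ _ surj] := coset_bij.
have [|C [a _ <-]] := surj [set y + z | z in unif_ideal t].
  by exists y => //; rewrite int_closure_ge.
move=> E; have : [set y + z | z in unif_ideal t] y.
  by exists 0; rewrite ?addr0 // unif_idealE; exact: vge0.
rewrite -E => -[b _ [z]]; rewrite unif_idealE => hz <-.
by exists b; rewrite addrC addKr.
Qed.

Hypothesis m_ideal : ideal m.

Lemma ideal0 : m 0.
Proof. by have [] := (submoduleP _).1 m_ideal. Qed.

(** The map R / m -> Rbar / t Rbar sends the class of 0 to m + t Rbar, which is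
    a coset of t Rbar; hence m lies in t Rbar. Conversely an element of R in t
    Rbar has the same image as 0, and the map is injective. *)
Lemma max_ideal_ge1 (a : R) : m a <-> vge v 1 a%:F.
Proof.
have [fun_ inj _] := coset_bij.
have coset_m b : cosets [set: R] m [set b + y | y in m] by exists b.
split=> [ma|ha].
  have [u hu E] := fun_ _ (coset_m 0).
  have inE b : m b -> (coset_map [set 0 + y | y in m]) b%:F.
    move=> mb; exists b; first by exists b; rewrite ?add0r.
    by exists 0; rewrite ?addr0 // unif_idealE; exact: vge0.
  have := inE _ ma; have := inE _ ideal0; rewrite -E unif_idealE => -[z0 h0 E0] [z h E1].
  have -> : a%:F = z - z0 by rewrite -[LHS]subr0 -E1 -tofrac0 -E0 opprD addrACA subrr add0r.
  exact: vgeB.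
have : [set a + y | y in m] = [set 0 + y | y in m].
  apply: inj; rewrite ?inE //; apply/seteqP; split.
    move=> _ [_ [b mb <-] [z hz <-]]; exists b; first by exists b; rewrite ?add0r.
    exists (a%:F + z); last by rewrite tofracD addrCA addrA.
    by rewrite unif_idealE in hz *; exact: vgeD.
  move=> _ [_ [b mb <-] [z hz <-]]; exists (a + b); first by exists b.
  exists (z - a%:F); last by rewrite add0r tofracD addrC addrA subrK addrC.
  by rewrite unif_idealE in hz *; exact: vgeB.
move=> E; have : [set a + y | y in m] a by exists 0; rewrite ?addr0 //; exact: ideal0.
by rewrite E => -[b mb]; rewrite add0r => <-.
Qed.

Hypothesis Rbar_finite : finitely_generated (int_closure R).

(** A common denominator b of generators of Rbar multiplies Rbar into R. *)
Lemma conductor_exists : exists k : nat, vge v k%:Z `<=` ringK R.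
Proof.
have [n [g gE]] := Rbar_finite; have [b b0 hb] := common_denom g.
have b0' : b%:F != 0 by rewrite tofrac_eq0.
have bR y : vge v 0 y -> ringK R (b%:F * y).
  rewrite -int_closure_ge gE => -[a _ <-]; rewrite mulr_sumr.
  elim/big_ind: _ => [|y' z hy hz|i _]; first exact: submod0 (ringK_sub R).
    by apply: submodD => //; exact: ringK_sub.
  by rewrite fracZE mulrCA; apply: submodM; [exact: ringK_sub|exact: hb].
have [k vb k0] := vge_fin v_val b0' (tofrac_ge0 b).
exists `|k|%N => y hy; rewrite -(mulVKf b0' y); apply: bR.
have := vgeM v_val (vge_of_eq (vV v_val vb)) hy.
by have -> : - k + `|k|%N = 0 by lia.
Qed.

End Hypotheses.

Theorem theorem4p7 (R : idomainType) (m : set R) (t : {fraction R})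
  (v : {fraction R} -> \bar int) (s : nat -> nat) (x : R) (e p : nat)
  (R_noetherian : noetherian R)
  (R_local : local_ring m)
  (R_dim1 : krull_dim R 1)
  (k_infinite : infinite_set (cosets [set: R] m))
  (Rbar_finite : finitely_generated (int_closure R))
  (v_valuation : discrete_valuation v)
  (Rbar_dvr : int_closure R = valuation_ring v)
  (t_unif : v t = 1%:E)
  (R_residue : residually_rational m t)
  (s_increasing : {homo s : i j / (i < j)%N})
  (s_range : range s = value_set v)
  (x_in_m : m x)
  (v_x : v (tofrac x) = (e%:Z)%:E)
  (e_min : forall k, values v m k -> (e <= k)%N)
  (p_range : (cond_len R - e <= p * e < cond_len R)%N)
  (p_pos : (1 <= p)%N)
  (R_not_gorenstein : ~ gorenstein R) :
  let c := cond_len R in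
  let n := len (ringK R) (conductor R) in
  let r := cm_type m in
  let b := b_inv m in
  let vR := value_set v in
  let ts := type_seq v s in
  let r_ i := type_term v s i in
  let lx := len (ringK R) (cond_plus x) in
  let multiples := [seq (i * e)%N | i <- iota 0 p.+1] in
  (* (1) *)
  ([/\ b < r%:Z - 1 <->
         vR = list_then multiples c /\ (p * e + 2 < c <= (p + 1) * e)%N,
       b < r%:Z - 1 <->
         ts = rcons (nseq n.-1 (e - 1)%N) (r_ n) /\ (1 < r_ n)%N &
       b < r%:Z - 1 ->
         [/\ lx = 1%N, c%:Z = (p%:Z + 1) * e%:Z - b, r%:Z = e%:Z - 1 &
             (r_ n)%:Z = e%:Z - 1 - b]]) /\
  (* (2) *)
  ([/\ b = r%:Z - 1 -> r%:Z = e%:Z - 1 \/ r%:Z = e%:Z - 2,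
       [/\ b = r%:Z - 1 /\ b = e%:Z - 2 <->
             vR = list_then multiples c /\ c = (p * e + 2)%N,
           b = r%:Z - 1 /\ b = e%:Z - 2 <->
             ts = rcons (nseq n.-1 (e - 1)%N) 1%N &
           b = r%:Z - 1 /\ b = e%:Z - 2 -> lx = 1%N] &
       [/\ b = r%:Z - 1 /\ b = e%:Z - 3 <->
             vR = list_then [:: 0; e; 2 * e - 1; 2 * e]%N (3 * e - 1) \/
             (exists2 y : nat, (e < y)%N && (2 * (y - e) <= e - 1)%N &
                vR = list_then [:: 0; e; y]%N (2 * e)),
           b = r%:Z - 1 /\ b = e%:Z - 3 <->
             (ts = [:: e - 2; e - 2; r_ 3; r_ 4]%N /\
                (r_ 3 + r_ 4 = e - 1)%N) \/
             (ts = [:: e - 2; r_ 2; r_ 3]%N /\ (r_ 2 + r_ 3 = e - 1)%N) &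
           b = r%:Z - 1 /\ b = e%:Z - 3 -> lx = 2%N]]) /\
  (* (3) *)
  (b = r%:Z ->
     let case_g := r%:Z = e%:Z - 2 /\ lx = 2%N in
     let case_j := [/\ r = 2%N, e = 5%N & lx = 3%N] in
     [/\ case_g \/ case_j,
         case_g ->
           [\/ vR = list_then [:: 0; 4; 8; 9; 12; 13]%N 16,
               vR = list_then [:: 0; 4; 8; 11; 12; 15; 16]%N 19,
               (4 <= e)%N /\
                 vR = list_then [:: 0; e; 2 * e - 2; 2 * e]%N (3 * e - 2) |
               (4 <= e)%N /\
                 exists2 z : nat, (0 < z)%N && (2 * z <= e - 2)%N &
                   vR = list_then [:: 0; e; e + z]%N (2 * e - 1)] &
         case_j ->
           [\/ vR = list_then [:: 0; 5; 6; 7]%N 10,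
               vR = list_then [:: 0; 5; 6; 8]%N 10 |
               vR = list_then [:: 0; 5; 8; 9; 10]%N 13]]).
Proof.
have R_ge0 := tofrac_ge0 Rbar_dvr.
have residual := residue_lift v_valuation Rbar_dvr t_unif R_residue.
have Rbar := int_closure_ge Rbar_dvr.
have [[m_ideal _ _] _] := R_local.
have m_ge1 := max_ideal_ge1 v_valuation Rbar_dvr t_unif R_residue m_ideal.
pose Q k := `[< vge v k%:Z `<=` ringK R >].
have exQ : exists k, Q k.
  by have [k hk] := conductor_exists v_valuation Rbar_dvr Rbar_finite; exists k; apply/asboolP.
case: (ex_minnP exQ) => c /asboolP c_sub cmin.
have c_min k : vge v k `<=` ringK R -> c%:Z <= k.
  move=> hk; have k0 : 0 <= k.
    have [y vy] := v_exists v_valuation k.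
    have [a _ aE] := hk y (vge_of_eq vy).
    by apply/(vgeE _ vy); rewrite -aE.
  have : (c <= `|k|)%N by apply: cmin; apply/asboolP; have -> : `|k|%N = k :> int by lia.
  by lia.
have cE := cond_lenE v_valuation R_ge0 residual c_sub c_min Rbar.
have e_gt0 : (0 < e)%N by have /m_ge1/(vgeE _ v_x) := x_in_m; lia.
have e_min' k : (0 < k)%N -> Sb v k -> (e <= k)%N.
  move=> k0 /asboolP[a [_ a0 va]]; apply: e_min; exists a; split=> //.
  by apply/m_ge1/(vgeE _ va); lia.
have c_gt0 : (0 < c)%N by rewrite -cE; case/andP: p_range; lia.
rewrite cE in p_range *; rewrite (len_ringK_conductor v_valuation R_ge0 residual c_sub c_min Rbar).
exact: (equivalences v_valuation R_ge0 residual c_sub c_min m_ge1 Rbar c_gt0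
  s_increasing s_range v_x e_gt0 e_min' p_range p_pos R_not_gorenstein).
Qed.
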